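(* Let $\alpha_0,\dots,\alpha_4\in\mathbb{C}$ with $\alpha_0+\alpha_1+\alpha_2+\alpha_3+\alpha_4=1$. The $A_4^{(1)}$ Painlevé equation $A_4(\alpha_0,\alpha_1,\alpha_2,\alpha_3,\alpha_4)$ has a rational solution if and only if the parameters satisfy one of the following three conditions; moreover, if a rational solution exists, it is unique. (1) $\alpha_0,\alpha_1,\dots,\alpha_4\in\mathbb{Z}$. (2) For some $i\in\{0,1,2,3,4\}$ (indices modulo $5$), $(\alpha_i,\alpha_{i+1},\alpha_{i+2},\alpha_{i+3},\alpha_{i+4})\equiv \pm\frac13(1,1,1,0,0)$ or $\equiv \pm\frac13(1,-1,-1,1,0)$ modulo $\mathbb{Z}$ (componentwise). (3) For some $i\in\{0,1,2,3,4\}$ and some $j\in\{1,2,3,4\}$, $(\alpha_i,\alpha_{i+1},\alpha_{i+2},\alpha_{i+3},\alpha_{i+4})\equiv \frac j5(1,1,1,1,1)$ or $\equiv \frac j5(1,2,1,3,3)$ modulo $\mathbb{Z}$ (componentwise). (4) Furthermore, by a suitable Bäcklund transformation, the rational solution in class (1), (2), (3) is respectively transformed into: (i) $(f_0,f_1,f_2,f_3,f_4)=(t,0,0,0,0)$ with $(\alpha_0,\dots,\alpha_4)=(1,0,0,0,0)$; (ii) $(f_0,f_1,f_2,f_3,f_4)=(\frac t3,\frac t3,\frac t3,0,0)$ with $(\alpha_0,\dots,\alpha_4)=(\frac13,\frac13,\frac13,0,0)$; (iii) $(f_0,f_1,f_2,f_3,f_4)=(\frac t5,\frac t5,\frac t5,\frac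 t5,\frac t5)$ with $(\alpha_0,\dots,\alpha_4)=(\frac15,\frac15,\frac15,\frac15,\frac15)$.
   Context: The $A_4^{(1)}$ Painlevé equation $A_4(\alpha_0,\dots,\alpha_4)$ with complex parameters $\alpha_j$ is the system for five functions $f_0,\dots,f_4$ of the complex variable $t$ (indices of $f_j$ and $\alpha_j$ taken in $\mathbb{Z}/5\mathbb{Z}$, ${}'=d/dt$): $f_j'=f_j(f_{j+1}-f_{j+2}+f_{j+3}-f_{j+4})+\alpha_j$ for $j=0,\dots,4$, together with $f_0+f_1+f_2+f_3+f_4=t$; this forces $\sum_j\alpha_j=1$. A rational solution is a tuple $(f_0,\dots,f_4)$ of rational functions of $t$ satisfying the system. Bäcklund transformations: the group generated by $s_0,\dots,s_4,\pi$, acting on (solution, parameters) by: $s_i(f_i)=f_i$, $s_i(f_{i+1})=f_{i+1}+\alpha_i/f_i$, $s_i(f_{i-1})=f_{i-1}-\alpha_i/f_i$, $s_i(f_k)=f_k$ for $k\neq i,i\pm1$; $s_i(\alpha_i)=-\alpha_i$, $s_i(\alpha_{i\pm1})=\alpha_{i\pm1}+\alpha_i$, $s_i(\alpha_k)=\alpha_k$ otherwise; $\pi(f_j)=f_{j+1}$, $\pi(\alpha_j)=\alpha_{j+1}$. If $f_i\equiv0$, $s_i$ is taken to be the identity. These map solutions of $A_4(\alpha)$ to solutions of the equation with transformed parameters. *)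

(* Defs.v *)
From mathcomp Require Import all_boot all_algebra.
From mathcomp Require Import reals.
From mathcomp Require Import complex.
Set Implicit Arguments. Unset Strict Implicit. Unset Printing Implicit Defensive.
Import GRing.Theory.
Local Open Scope ring_scope.

Section A4.
Variable R : realType.

Definition Cx := R[i].
Definition RatF := {fraction {poly Cx}}.

Definition sh (i : 'I_5) (k : nat) : 'I_5 := inord ((i + k) %% 5).

Definition tof (p : {poly Cx}) : RatF := @FracField.tofrac _ p.

Definition tvar : RatF := tof 'X.
Definition cst (c : Cx) : RatF := tof c%:P.

Definition fderiv (x : RatF) : RatF :=
  let r := repr x in
  tof ((\n_r)^`() * \d_r - \n_r * (\d_r)^`()) / tof ((\d_r) ^+ 2).

Definition is_A4_solution (a : 'I_5 -> Cx) (f : 'I_5 -> RatF) : Prop :=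
  (forall j : 'I_5,
     fderiv (f j) = f j * (f (sh j 1) - f (sh j 2) + f (sh j 3) - f (sh j 4))
                    + cst (a j))
  /\ \sum_(j < 5) f j = tvar.

Definition state := ((('I_5 -> RatF) * ('I_5 -> Cx)))%type.

Inductive gen := Gs of 'I_5 | Gpi.

Definition act_s (i : 'I_5) (st : state) : state :=
  let: (f, a) := st in
  if f i == 0 then (f, a) else
  ((fun k => if k == sh i 1 then f k + cst (a i) / f i
             else if k == sh i 4 then f k - cst (a i) / f i
             else f k),
   (fun k => if k == i then - a i
             else if (k == sh i 1) || (k == sh i 4) then a k + a i
             else a k)).

Definition act_pi (st : state) : state :=
  let: (f, a) := st in ((fun j => f (sh j 1)), (fun j => a (sh j 1))).

Definition act (g : gen) (st : state) : state :=
  match g with Gs i => act_s i st | Gpi => act_pi st end.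

Definition backlund (w : seq gen) (st : state) : state := foldr act st w.

Definition congZ (x y : Cx) : Prop := exists z : int, x - y = z%:~R.

Definition vec5 (s : seq int) (k : 'I_5) : Cx := (nth 0 s k)%:~R.

Definition cond1 (a : 'I_5 -> Cx) : Prop :=
  forall k : 'I_5, exists z : int, a k = z%:~R.

Definition cond2 (a : 'I_5 -> Cx) : Prop :=
  exists (i : 'I_5) (e : Cx), (e = 3%:R^-1 \/ e = - 3%:R^-1) /\
   ((forall k : 'I_5, congZ (a (sh i k)) (e * vec5 [:: 1; 1; 1; 0; 0]%R k)) \/
    (forall k : 'I_5, congZ (a (sh i k)) (e * vec5 [:: 1; -1; -1; 1; 0]%R k))).

Definition cond3 (a : 'I_5 -> Cx) : Prop :=
  exists (i : 'I_5) (j : nat), (1 <= j <= 4)%N /\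
   ((forall k : 'I_5, congZ (a (sh i k)) (j%:R / 5%:R * vec5 [:: 1; 1; 1; 1; 1]%R k)) \/
    (forall k : 'I_5, congZ (a (sh i k)) (j%:R / 5%:R * vec5 [:: 1; 2; 1; 3; 3]%R k))).

Definition seed1 : state :=
  ((fun j : 'I_5 => if j == 0 :> nat then tvar else 0),
   (fun j : 'I_5 => if j == 0 :> nat then 1 else 0)).
Definition seed2 : state :=
  ((fun j : 'I_5 => if (j < 3)%N then tvar / 3%:R else 0),
   (fun j : 'I_5 => if (j < 3)%N then 3%:R^-1 else 0)).
Definition seed3 : state :=
  ((fun _ : 'I_5 => tvar / 5%:R), (fun _ : 'I_5 => 5%:R^-1)).

End A4.

(* Main.v *)
(** Put [f_j = N_j / D] in lowest terms.  Comparing leading terms at a root of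
    [D], every pole is simple, with residue vector a rotation of (1,-1,0,0,0),
    (-1,0,1,0,0) or (3,1,-1,-3,0); at infinity [f_j ~ c_j t] with [c] a rotation
    of (1,0,0,0,0), (1,1,1,0,0)/3, (1,1,1,1,1)/5 or (1,1,0,-1,0), and the next
    coefficients [r_j] are sums of residues, hence integers.  As
    [alpha_j = c_j - c_j (A r)_j - r_j (A c)_j], all [15 alpha_j] are integers.

    The Baecklund reflections act on solutions and, on parameters, as an affine
    Weyl group, so one may move [alpha] into the chamber [alpha_j >= 0].  There
    one looks at the five Hamiltonians [h_k = sum f_i f_(i+1) f_(i+2) + linear]
    with [h_k' = f_(k+1) f_(k+2) + f_(k-1) f_(k+1) + f_(k-2) f_(k-1)].  They have
    simple poles with residues >= 0, not all zero at any given pole, so their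
    1/t-coefficients at infinity, quadratic in [r] and [alpha], are >= 0.  A
    finite check shows that in the chamber this forces [r = 0]: there is no
    pole, and [f_j = alpha_j t] is a rotated seed.  Existence, uniqueness and the
    reduction to seeds are then transported back along the reflections. *)

Require Import Defs.
From HB Require Import structures.
From mathcomp Require Import all_boot all_algebra.
From mathcomp Require Import reals.
From mathcomp Require Import complex.
From mathcomp Require Import all_order boolp separable ring lra zify.
Import Order.TTheory GRing.Theory Num.Theory.
Local Open Scope ring_scope.

Set Implicit Arguments. Unset Strict Implicit. Unset Printing Implicit Defensive.

(** * Cyclic indices and the derivation on rational functions *)

Lemma sh0 i : sh i 0 = i.
Proof. by apply: val_inj; rewrite /= inordK ?ltn_mod // addn0 modn_small. Qed.

Lemma sh_sh i a b : sh (sh i a) b = sh i (a + b).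
Proof.
by apply: val_inj; rewrite /sh /= !inordK ?ltn_mod // modnDml addnA.
Qed.

Lemma shD5 i k : sh i k.+4.+1 = sh i k.
Proof. by rewrite /sh -[k.+4.+1]/(5 + k)%N addnCA modnDl. Qed.

Lemma sh_eq i a b : (sh i a == sh i b) = (a == b %[mod 5]).
Proof.
rewrite -val_eqE /= !inordK ?ltn_mod //; exact: eqn_modDl.
Qed.

Lemma sh_sub (i j : 'I_5) : exists2 k, (k < 5)%N & j = sh i k.
Proof.
exists ((j + (5 - i)) %% 5)%N; first exact: ltn_mod.
apply: val_inj; rewrite /= inordK ?ltn_mod // modnDmr.
have := ltn_ord i; have := ltn_ord j; lia.
Qed.

(** Together with [sum_sh] and [sh_ind] this turns a cyclic identity into an identity in five
    independent variables, which [ring], [field] or [lra] can settle. *)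
Lemma shE i :
    (sh (sh i 1) 1 = sh i 2) * (sh (sh i 1) 2 = sh i 3) *
    (sh (sh i 1) 3 = sh i 4) * (sh (sh i 1) 4 = i) *
    (sh (sh i 2) 1 = sh i 3) * (sh (sh i 2) 2 = sh i 4) *
    (sh (sh i 2) 3 = i) * (sh (sh i 2) 4 = sh i 1) *
    (sh (sh i 3) 1 = sh i 4) * (sh (sh i 3) 2 = i) *
    (sh (sh i 3) 3 = sh i 1) * (sh (sh i 3) 4 = sh i 2) *
    (sh (sh i 4) 1 = i) * (sh (sh i 4) 2 = sh i 1) *
    (sh (sh i 4) 3 = sh i 2) * (sh (sh i 4) 4 = sh i 3)%type.
Proof.
by do !split; rewrite sh_sh //;
   first [exact: shD5 | exact: etrans (shD5 i 0) (sh0 i)].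
Qed.

Lemma sh_ind i (P : 'I_5 -> Prop) :
  P i -> P (sh i 1) -> P (sh i 2) -> P (sh i 3) -> P (sh i 4) -> forall j, P j.
Proof.
move=> P0 P1 P2 P3 P4 j; have [k + ->] := sh_sub i j.
by do 5 (case: k => [|k]; rewrite ?sh0 //).
Qed.

Lemma sum_sh (V : nmodType) (f : 'I_5 -> V) i :
  \sum_j f j = f i + f (sh i 1) + f (sh i 2) + f (sh i 3) + f (sh i 4).
Proof.
have shI : injective (fun k : 'I_5 => sh i k).
  move=> k l /eqP; rewrite sh_eq => /eqP e; apply: val_inj.
  by move: e; rewrite !modn_small // ltn_ord.
rewrite (reindex_inj shI) !big_ord_recl big_ord0 /= sh0 addr0 !addrA.
by [].
Qed.

(** The antisymmetric circulant operator written A in the overview; the system reads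
    [f j * alt f j + cst (a j)]. *)
Definition alt (V : zmodType) (f : 'I_5 -> V) (j : 'I_5) :=
  f (sh j 1) - f (sh j 2) + f (sh j 3) - f (sh j 4).

Section FieldIdentities.
Variable K : fieldType.
Implicit Types p q u v dp dq du dv x c dx : K.

Lemma deriv_sum_identity p q u v dp dq du dv : q != 0 -> v != 0 ->
  (((dp * v + p * dv) + (du * q + u * dq)) * (q * v)
     - (p * v + u * q) * (dq * v + q * dv)) / (q * v) ^+ 2
  = (dp * q - p * dq) / q ^+ 2 + (du * v - u * dv) / v ^+ 2.
Proof. by move=> q0 v0; field; rewrite ?q0 ?v0. Qed.

Lemma deriv_prod_identity p q u v dp dq du dv : q != 0 -> v != 0 ->
  ((dp * u + p * du) * (q * v) - (p * u) * (dq * v + q * dv)) / (q * v) ^+ 2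
  = (dp * q - p * dq) / q ^+ 2 * (u / v)
    + p / q * ((du * v - u * dv) / v ^+ 2).
Proof. by move=> q0 v0; field; rewrite ?q0 ?v0. Qed.

Lemma deriv_inv_identity x dx : x != 0 ->
  - dx / x ^+ 2 * x + x^-1 * dx = 0.
Proof. by move=> x0; field. Qed.

End FieldIdentities.

Section Derivation.
Variable R : realType.
Local Notation F := (RatF R).
Local Notation tof := (@Defs.tof R).
Implicit Types (p q : {poly Cx R}) (x y : F) (c : Cx R).

HB.instance Definition _ := GRing.isZmodMorphism.Build {poly Cx R} F (@Defs.tof R)
  (@tofrac_is_zmod_morphism _).
HB.instance Definition _ := GRing.isMonoidMorphism.Build {poly Cx R} F (@Defs.tof R)
  (@tofrac_is_monoid_morphism _).

Lemma tof_eq0 p : (tof p == 0) = (p == 0).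
Proof. exact: tofrac_eq0. Qed.

Lemma tof_inj : injective tof.
Proof. by move=> p q /eqP; rewrite tofrac_eq => /eqP. Qed.


Lemma repr_tof x : x = tof \n_(repr x) / tof \d_(repr x).
Proof.
have d0 : tof \d_(repr x) != 0 by rewrite tof_eq0 denom_ratioP.
apply: (mulIf d0); rewrite divfK // /Defs.tof; move: (repr x) (reprK x) => r <-.
unlock FracField.tofrac; rewrite -[LHS]FracField.pi_mul.
apply/eqmodP; rewrite /= FracField.equivfE /FracField.mulf /=.
by rewrite !numden_Ratio ?oner_eq0 ?mulf_neq0 ?denom_ratioP ?oner_eq0 //= !mulr1 mulrC.
Qed.

Lemma tof_fracP x : exists p q, q != 0 /\ x = tof p / tof q.
Proof.
exists \n_(repr x), \d_(repr x).
by split; [exact: denom_ratioP | exact: repr_tof].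
Qed.

(** [fderiv] is defined through the representative chosen by [repr]. Differentiating the cross
    relation [n * q = p * d] shows that the quotient rule takes the same value on every
    representative. *)
Lemma fderiv_frac p q : q != 0 ->
  fderiv (tof p / tof q) = tof (p^`() * q - p * q^`()) / tof (q ^+ 2).
Proof.
move=> q0; rewrite /fderiv; set x := tof p / tof q.
set n := \n_(repr x); set d := \d_(repr x).
have d0 : d != 0 by apply: denom_ratioP.
have e : n * q = p * d.
  apply: tof_inj; rewrite !rmorphM; apply/eqP.
  by rewrite -eqr_div ?tof_eq0 // -repr_tof.
have e' : n^`() * q = p^`() * d + p * d^`() - n * q^`().
  by rewrite -derivM -e derivM addrK.
apply/eqP; rewrite eqr_div ?tof_eq0 ?expf_neq0 // -!rmorphM; apply/eqP.
congr tof; rewrite mulrBl.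
have -> : n^`() * d * q ^+ 2 = d * q * (n^`() * q) by ring.
have -> : n * d^`() * q ^+ 2 = q * d^`() * (n * q) by ring.
rewrite e'.
have -> : d * q * (p^`() * d + p * d^`() - n * q^`()) =
   d * q * (p^`() * d + p * d^`()) - d * q^`() * (n * q) by ring.
by rewrite e; ring.
Qed.

Lemma fderivD x y : fderiv (x + y) = fderiv x + fderiv y.
Proof.
have [p [q [q0 ->]]] := tof_fracP x; have [u [v [v0 ->]]] := tof_fracP y.
rewrite addf_div ?tof_eq0 // -!rmorphM -rmorphD !fderiv_frac ?mulf_neq0 //.
rewrite !(derivD, derivM) !(rmorphB, rmorphD, rmorphM, rmorphXn) /=.
by apply: deriv_sum_identity; rewrite tof_eq0.
Qed.

Lemma fderivM x y : fderiv (x * y) = fderiv x * y + x * fderiv y.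
Proof.
have [p [q [q0 ->]]] := tof_fracP x; have [u [v [v0 ->]]] := tof_fracP y.
rewrite mulf_div -!rmorphM !fderiv_frac ?mulf_neq0 //.
rewrite !derivM !(rmorphB, rmorphD, rmorphM, rmorphXn) /=.
by apply: deriv_prod_identity; rewrite tof_eq0.
Qed.

Lemma fderiv_tof p : fderiv (tof p) = tof p^`().
Proof.
rewrite -[tof p]divr1 -[1](rmorph1 tof) fderiv_frac ?oner_eq0 //.
by rewrite -polyC1 derivC mulr0 subr0 polyC1 expr1n mulr1 rmorph1 divr1.
Qed.

Lemma fderiv_cst c : fderiv (cst c) = 0.
Proof. by rewrite fderiv_tof derivC rmorph0. Qed.

Lemma fderiv_tvar : fderiv (tvar R) = 1.
Proof. by rewrite fderiv_tof derivX rmorph1. Qed.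

Lemma fderiv0 : fderiv 0 = 0 :> F.
Proof. by rewrite -(rmorph0 tof) fderiv_tof linear0 rmorph0. Qed.

Lemma fderivV x : x != 0 -> fderiv x^-1 = - fderiv x / x ^+ 2.
Proof.
move=> x0; apply: (mulIf x0); apply: (addIr (x^-1 * fderiv x)).
rewrite -fderivM mulVf // -(rmorph1 tof) -polyC1 (fderiv_cst 1).
by rewrite deriv_inv_identity.
Qed.

Lemma cst_is_additive : zmod_morphism (@cst R).
Proof. by move=> c d; rewrite /cst polyCB rmorphB. Qed.

Lemma cst_is_monoid : monoid_morphism (@cst R).
Proof. by split=> [|c d]; rewrite /cst ?polyC1 ?rmorph1 // polyCM rmorphM. Qed.

HB.instance Definition _ := GRing.isZmodMorphism.Build (Cx R) F (@cst R)
  cst_is_additive.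
HB.instance Definition _ := GRing.isMonoidMorphism.Build (Cx R) F (@cst R)
  cst_is_monoid.

Lemma fderiv_cst_div c x : x != 0 ->
  fderiv (cst c / x) = - cst c * fderiv x / x ^+ 2.
Proof.
by move=> x0; rewrite fderivM fderiv_cst mul0r add0r fderivV // !mulNr mulrN mulrA.
Qed.

End Derivation.

(** * Reflections act on solutions *)

Definition sact (V : zmodType) (i : 'I_5) (a : 'I_5 -> V) (k : 'I_5) : V :=
  if k == i then - a i
  else if (k == sh i 1) || (k == sh i 4) then a k + a i else a k.

Lemma sh1_neq i : (sh i 1 == i) = false.
Proof. by rewrite -{2}(sh0 i) sh_eq. Qed.
Lemma sh2_neq i : (sh i 2 == i) = false.
Proof. by rewrite -{2}(sh0 i) sh_eq. Qed.
Lemma sh3_neq i : (sh i 3 == i) = false.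
Proof. by rewrite -{2}(sh0 i) sh_eq. Qed.
Lemma sh4_neq i : (sh i 4 == i) = false.
Proof. by rewrite -{2}(sh0 i) sh_eq. Qed.
Lemma neq_sh i k : (i == sh i k) = (sh i k == i).
Proof. exact: eq_sym. Qed.

Definition sh_neq := (sh1_neq, sh2_neq, sh3_neq, sh4_neq).

Section Sact.
Variables (V : zmodType) (i : 'I_5) (a : 'I_5 -> V).

Lemma sact0 : sact i a i = - a i.
Proof. by rewrite /sact eqxx. Qed.
Lemma sact1 : sact i a (sh i 1) = a (sh i 1) + a i.
Proof. by rewrite /sact sh_neq eqxx. Qed.
Lemma sact2 : sact i a (sh i 2) = a (sh i 2).
Proof. by rewrite /sact sh_neq !sh_eq. Qed.
Lemma sact3 : sact i a (sh i 3) = a (sh i 3).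
Proof. by rewrite /sact sh_neq !sh_eq. Qed.
Lemma sact4 : sact i a (sh i 4) = a (sh i 4) + a i.
Proof. by rewrite /sact sh_neq eqxx orbT. Qed.

Definition sactE := (sact0, sact1, sact2, sact3, sact4).

End Sact.

Lemma sact_sum (V : comNzRingType) i (a : 'I_5 -> V) :
  \sum_j sact i a j = \sum_j a j.
Proof. by rewrite !(sum_sh _ i) !sactE; ring. Qed.

Lemma sact_invol (V : zmodType) i : involutive (@sact V i).
Proof.
move=> a; apply/funext => k; move: k; apply: (@sh_ind i); rewrite !sactE ?opprK //.
  by rewrite addrK.
by rewrite addrK.
Qed.

Section FieldIdentities2.
Variable K : fieldType.
Variables (f0 f1 f2 f3 f4 a0 a1 a2 a3 a4 d0 d1 d2 d3 d4 : K).
Hypothesis f00 : f0 != 0.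
Hypothesis e0 : d0 = f0 * (f1 - f2 + f3 - f4) + a0.
Hypothesis e1 : d1 = f1 * (f2 - f3 + f4 - f0) + a1.
Hypothesis e2 : d2 = f2 * (f3 - f4 + f0 - f1) + a2.
Hypothesis e3 : d3 = f3 * (f4 - f0 + f1 - f2) + a3.
Hypothesis e4 : d4 = f4 * (f0 - f1 + f2 - f3) + a4.

Lemma backlund_identity0 :
  d0 = f0 * (f1 + a0 / f0 - f2 + f3 - (f4 - a0 / f0)) - a0.
Proof. by rewrite e0; field. Qed.

Lemma backlund_identity1 : d1 + - a0 * d0 / f0 ^+ 2 =
  (f1 + a0 / f0) * (f2 - f3 + (f4 - a0 / f0) - f0) + (a1 + a0).
Proof. by rewrite e0 e1; field. Qed.

Lemma backlund_identity2 :
  d2 = f2 * (f3 - (f4 - a0 / f0) + f0 - (f1 + a0 / f0)) + a2.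
Proof. by rewrite e2; ring. Qed.

Lemma backlund_identity3 :
  d3 = f3 * ((f4 - a0 / f0) - f0 + (f1 + a0 / f0) - f2) + a3.
Proof. by rewrite e3; ring. Qed.

Lemma backlund_identity4 : d4 - - a0 * d0 / f0 ^+ 2 =
  (f4 - a0 / f0) * (f0 - (f1 + a0 / f0) + f2 - f3) + (a4 + a0).
Proof. by rewrite e0 e4; field. Qed.

Lemma backlund_identity_sum x :
  f0 + (f1 + x) + f2 + f3 + (f4 - x) = f0 + f1 + f2 + f3 + f4.
Proof. by ring. Qed.

Lemma ray_identity t a b1 b2 b3 b4 :
  t * a * (t * b1 - t * b2 + t * b3 - t * b4)
  = t * t * (a * (b1 - b2 + b3 - b4)) :> K.
Proof. by ring. Qed.

End FieldIdentities2.

Section Backlund.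
Variable R : realType.
Local Notation F := (RatF R).
Local Notation C := (Cx R).
Implicit Types (f g : 'I_5 -> F) (a b : 'I_5 -> C).

Definition sfun i a f (k : 'I_5) : F :=
  if k == sh i 1 then f k + cst (a i) / f i
  else if k == sh i 4 then f k - cst (a i) / f i else f k.

Section Values.
Variables (i : 'I_5) (a : 'I_5 -> C) (f : 'I_5 -> F).
Lemma sfun0 : sfun i a f i = f i.
Proof. by rewrite /sfun !neq_sh !sh_neq. Qed.
Lemma sfun1 : sfun i a f (sh i 1) = f (sh i 1) + cst (a i) / f i.
Proof. by rewrite /sfun eqxx. Qed.
Lemma sfun2 : sfun i a f (sh i 2) = f (sh i 2).
Proof. by rewrite /sfun !sh_eq. Qed.
Lemma sfun3 : sfun i a f (sh i 3) = f (sh i 3).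
Proof. by rewrite /sfun !sh_eq. Qed.
Lemma sfun4 : sfun i a f (sh i 4) = f (sh i 4) - cst (a i) / f i.
Proof. by rewrite /sfun sh_eq eqxx. Qed.
Definition sfunE := (sfun0, sfun1, sfun2, sfun3, sfun4).
End Values.

Lemma sol_eq a f j : is_A4_solution a f ->
  fderiv (f j) = f j * alt f j + cst (a j).
Proof. by case=> + _; apply. Qed.

Lemma sol_zero a f i : is_A4_solution a f -> f i = 0 -> a i = 0.
Proof.
move=> /(sol_eq i) + e; rewrite e fderiv0 mul0r add0r -(rmorph0 (@cst R)).
by move=> /tof_inj/polyC_inj.
Qed.

(** If [f i] vanishes, the equation forces [a i = 0], so the identity prescribed in that case agrees
    with the uniform formulas [sfun] and [sact]. *)
Lemma act_sE a f i : is_A4_solution a f ->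
  act_s i (f, a) = (sfun i a f, sact i a).
Proof.
move=> s; rewrite /act_s; case: eqP => // fi0.
have ai0 := sol_zero s fi0; congr pair; apply/funext => k.
  by rewrite /sfun ai0 rmorph0 mul0r addr0 subr0; do 2?case: ifP.
rewrite /sact ai0 oppr0 addr0; case: eqP => [->|_] //.
by case: ifP.
Qed.

Lemma sol_sact a f i : is_A4_solution a f ->
  is_A4_solution (sact i a) (sfun i a f).
Proof.
move=> s; have [fi0|fi0] := eqVneq (f i) 0.
  by have := act_sE i s; rewrite /act_s fi0 eqxx; case=> <- <-.
have E k := sol_eq (sh i k) s; have E0 := sol_eq i s.
move: (E 1%N) (E 2%N) (E 3%N) (E 4%N) E0; rewrite /alt !shE => e1 e2 e3 e4 e0.
split; last first.
  case: s => _ <-; rewrite !(sum_sh _ i) !sfunE.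
  exact: backlund_identity_sum.
move=> j; move: j; apply: (@sh_ind i); do ?rewrite shE; rewrite !sfunE !sactE.
- by rewrite rmorphN; apply: backlund_identity0.
- rewrite fderivD fderiv_cst_div // rmorphD.
  exact: (backlund_identity1 fi0 e0 e1).
- by apply: backlund_identity2.
- by apply: backlund_identity3.
- rewrite -mulNr -rmorphN fderivD fderiv_cst_div // rmorphN rmorphD.
  transitivity (fderiv (f (sh i 4)) - - cst (a i) * fderiv (f i) / f i ^+ 2).
    by rewrite [cst (- a i)]rmorphN !mulNr.
  by rewrite (backlund_identity4 fi0 e0 e4) mulNr.
Qed.

(** [sfun i] keeps [f i] while [sact i] flips the sign of [a i], so the two corrections cancel. The
    resulting injectivity carries uniqueness along reflections. *)
Lemma sfun_invol a f i : sfun i (sact i a) (sfun i a f) = f.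
Proof.
apply/funext => k; move: k; apply: (@sh_ind i); rewrite !sfunE ?sactE //.
  by rewrite rmorphN mulNr addrK.
by rewrite rmorphN mulNr opprK addrNK.
Qed.

Lemma sfun_inj a i : injective (sfun i a).
Proof. by move=> f g e; rewrite -(sfun_invol a f i) e sfun_invol. Qed.

Lemma backlund_cat w1 w2 (st : state R) :
  backlund (w1 ++ w2) st = backlund w1 (backlund w2 st).
Proof. exact: foldr_cat. Qed.

Lemma backlund_pi k f a :
  backlund (nseq k Gpi) (f, a) = (fun j => f (sh j k), fun j => a (sh j k)).
Proof.
elim: k => [|k /= ->] /=.
  by congr pair; apply/funext => j; rewrite sh0.
by congr pair; apply/funext => j; rewrite sh_sh.
Qed.

Definition ray a : 'I_5 -> F := fun j => tvar R * cst (a j).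

(** The derivative of [t a_j] is the constant [a_j], so only the quadratic term [t^2 a_j (A a)_j]
    has to vanish. *)
Lemma sol_ray a : \sum_j a j = 1 -> (forall j, a j * alt a j = 0) ->
  is_A4_solution a (ray a).
Proof.
move=> s e; split=> [j|]; last first.
  by rewrite -mulr_sumr -rmorph_sum s rmorph1 mulr1.
rewrite fderivM fderiv_tvar fderiv_cst mulr0 addr0 mul1r /ray.
have := congr1 (@cst R) (e j); rewrite /alt rmorph0 rmorphM.
by rewrite !(rmorphB, rmorphD) ray_identity => ->; rewrite mulr0 add0r.
Qed.

End Backlund.

(** * Integer parameters: chamber, residue classes, rigidity *)

Section Descent.
Implicit Types X : 'I_5 -> int.

(* Squared distance to the barycentre [X j = 3] of the chamber, in the metric
   invariant under the affine Weyl group; parameters are scaled by 15. *)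
Definition energy X : int :=
  \sum_j ((X j - 3) ^+ 2 + (X j + X (sh j 1) - 6) ^+ 2).

Lemma energy_sact X i : \sum_j X j = 15 ->
  energy (sact i X) = energy X + 30 * X i.
Proof.
rewrite /energy !(sum_sh _ i) !shE !sactE.
move: (X i) (X (sh i 1)) (X (sh i 2)) (X (sh i 3)) (X (sh i 4)).
move=> x0 x1 x2 x3 x4 e; have -> : x4 = 15 - x0 - x1 - x2 - x3 by lia.
by ring.
Qed.

(** By [energy_sact], reflecting at a negative coordinate strictly lowers a nonnegative integer, so
    the descent ends in the chamber. *)
Lemma chamber_ind (P : ('I_5 -> int) -> Prop) :
  (forall X, \sum_j X j = 15 -> (forall j, 0 <= X j) -> P X) ->
  (forall X i, \sum_j X j = 15 -> P (sact i X) -> P X) ->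
  forall X, \sum_j X j = 15 -> P X.
Proof.
move=> Pch Ps X; have [n] := ubnP `|energy X|%N.
elim: n X => // n IHn X ltn sX.
have [/forallP pos|/forallPn[i neg]] := boolP [forall j, 0 <= X j].
  exact: Pch.
have sX' : \sum_j sact i X j = 15 by rewrite sact_sum.
apply: (Ps X i) => //; apply: IHn => //.
have ge0 Y : 0 <= energy Y.
  by apply: sumr_ge0 => j _; rewrite addr_ge0 ?sqr_ge0.
have := energy_sact i sX; have := ge0 X; have := ge0 (sact i X).
by move: ltn neg; lia.
Qed.

End Descent.

Definition cyc (v : seq int) (k : nat) : int := nth 0 v (k %% 5).

Definition congX (B : seq (seq int)) (X : 'I_5 -> int) : Prop :=
  exists i, exists2 v, v \in B & forall k, (15 %| X (sh i k) - cyc v k)%Z.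

(** The reflection in a form indexed by natural numbers, which [vm_compute] can evaluate in
    [stable_res]. *)
Definition sactN (V : zmodType) (l : nat) (u : nat -> V) (k : nat) : V :=
  if k == l %[mod 5] then - u l
  else if (k == l + 1 %[mod 5]) || (k == l + 4 %[mod 5]) then u k + u l else u k.

Lemma sactN_sact (V : zmodType) (X : 'I_5 -> V) i l k :
  sact (sh i l) X (sh i k) = sactN l (fun m => X (sh i m)) k.
Proof. by rewrite /sact /sactN !sh_sh !sh_eq. Qed.

Definition res1 : seq (seq int) := [:: [:: 0; 0; 0; 0; 0]].
Definition res2 : seq (seq int) :=
  [:: [:: 5; 5; 5; 0; 0]; [:: -5; -5; -5; 0; 0];
      [:: 5; -5; -5; 5; 0]; [:: -5; 5; 5; -5; 0]].
Definition res3 : seq (seq int) :=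
  [seq [seq 3 * Posz j * x | x <- v]
     | j <- [:: 1; 2; 3; 4], v <- [:: [:: 1; 1; 1; 1; 1]; [:: 1; 2; 1; 3; 3]]].

Definition stable (B : seq (seq int)) : bool :=
  all (fun v => all (fun l => has (fun i => has (fun v' => all (fun k =>
    (15 %| sactN l (cyc v) (i + k) - cyc v' k)%Z) (iota 0 5)) B) (iota 0 5))
    (iota 0 5)) B.

Lemma stable_res : [&& stable res1, stable res2 & stable res3].
Proof. by vm_compute. Qed.

Lemma cycM v k : cyc v (k %% 5) = cyc v k.
Proof. by rewrite /cyc modn_mod. Qed.

Lemma shM i k : sh i (k %% 5) = sh i k.
Proof. by apply/eqP; rewrite sh_eq modn_mod. Qed.

Lemma mod5_iota k : (k %% 5)%N \in iota 0 5.
Proof. by rewrite mem_iota /= ltn_mod. Qed.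

(** Reflections have integer coefficients, hence respect congruence modulo 15; [stable] provides the
    listed vector and the rotation for the image. *)
Lemma congX_sact B X i : stable B -> congX B X -> congX B (sact i X).
Proof.
move=> st [i0 [v vB e]]; have [l l5 ->] := sh_sub i0 i.
have lI : l \in iota 0 5 by rewrite mem_iota.
have /hasP[m _ /hasP[v' v'B /allP H]] := allP (allP st v vB) l lI.
exists (sh i0 m); exists v' => // k; rewrite -cycM -[sh _ k]shM.
have := H _ (mod5_iota k); set n := (k %% 5)%N; rewrite sh_sh sactN_sact.
have := e l; have := e (m + n)%N.
rewrite /sactN; do 2?case: ifP => _; lia.
Qed.

Definition chamber_pt (m : nat) : seq int :=
  nth [::] [:: [:: 15; 0; 0; 0; 0]; [:: 5; 5; 5; 0; 0]; [:: 3; 3; 3; 3; 3]] m.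

Definition resn m := nth [::] [:: res1; res2; res3] m.

Lemma cyc_ext (X : 'I_5 -> int) i v :
  [/\ X i = v`_0, X (sh i 1) = v`_1, X (sh i 2) = v`_2,
      X (sh i 3) = v`_3 & X (sh i 4) = v`_4] ->
  forall k, X (sh i k) = cyc v k.
Proof.
case=> e0 e1 e2 e3 e4 k; rewrite -shM -cycM.
have := mod5_iota k; rewrite !inE => /or4P[|||/orP[]] /eqP-> //.
by rewrite sh0.
Qed.

(** For [m = 0] all coordinates are multiples of 15, so a single one carries the whole sum.
    Otherwise the least nonnegative residues of a listed vector already sum to 15 for the seed and
    to at least 30 for all the others. *)
Lemma chamber_congX m X : (m < 3)%N -> congX (resn m) X ->
  (forall j, 0 <= X j) -> \sum_j X j = 15 ->
  exists i, forall k, X (sh i k) = cyc (chamber_pt m) k.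
Proof.
move=> m3 [i [v vB e]] pos; rewrite (sum_sh _ i) => sX.
move: (e 0%N) (e 1%N) (e 2%N) (e 3%N) (e 4%N); rewrite sh0 /cyc /=.
move: (pos i) (pos (sh i 1)) (pos (sh i 2)) (pos (sh i 3)) (pos (sh i 4)).
case: m m3 vB => [|[|[|//]]] _; rewrite !inE.
- move=> /eqP-> /=; rewrite !subr0 => p0 p1 p2 p3 p4 e0 e1 e2 e3 e4.
  have : [|| X i == 15, X (sh i 1) == 15, X (sh i 2) == 15,
    X (sh i 3) == 15 | X (sh i 4) == 15] by lia.
  case/or4P=> [|||/orP[]] /eqP eX; [exists i | exists (sh i 1)
    | exists (sh i 2) | exists (sh i 3) | exists (sh i 4)];
  by apply: cyc_ext; do ?rewrite shE; split=> /=; lia.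
- by case/or4P=> /eqP-> /= *; exists i; apply: cyc_ext; rewrite /=; split; lia.
- by do ?[case/orP]; move=> /eqP-> /= *;
     exists i; apply: cyc_ext; rewrite /=; split; lia.
Qed.

Section Rigidity.
Variable V : comNzRingType.
Implicit Types c r a : 'I_5 -> V.

(* The parameters, read off the leading coefficients [c] and the coefficients [r]
   of 1/t at infinity. *)
Definition infty_param c r j := c j - c j * alt r j - r j * alt c j.

(* The coefficient of 1/t of the k-th Hamiltonian at infinity. *)
Definition ham_res c r a k :=
  (a (sh k 2) + a (sh k 4)) * r (sh k 1) - a (sh k 1) * r (sh k 2)
  + a (sh k 4) * r (sh k 3) - (a (sh k 1) + a (sh k 3)) * r (sh k 4)
  + \sum_j (c j * r (sh j 1) * r (sh j 2) + r j * c (sh j 1) * r (sh j 2)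
            + r j * r (sh j 1) * c (sh j 2)).

End Rigidity.

(* 15 times the leading coefficients at infinity; the last type is never in the
   chamber. *)
Definition infty_types : seq (seq int) :=
  [:: [:: 15; 0; 0; 0; 0]; [:: 5; 5; 5; 0; 0]; [:: 3; 3; 3; 3; 3];
      [:: 15; 15; 0; -15; 0]].

Definition box : seq int := [:: -3; -2; -1; 0; 1; 2; 3].

(** [altN], [paramN] and [ham_resN] restate [alt], [infty_param] and [ham_res] without finite-type
    sums, so that [rigid_box] can be decided by computation. *)
Definition altN (u : nat -> int) k :=
  u (k + 1)%N - u (k + 2)%N + u (k + 3)%N - u (k + 4)%N.

Definition paramN (c r : nat -> int) k := c k - c k * altN r k - r k * altN c k.

Definition ham_resN (c r a : nat -> int) k :=
  (a (k + 2)%N + a (k + 4)%N) * r (k + 1)%N - a (k + 1)%N * r (k + 2)%N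
  + a (k + 4)%N * r (k + 3)%N - (a (k + 1)%N + a (k + 3)%N) * r (k + 4)%N
  + foldr (fun j s => (c j * r (j + 1)%N * r (j + 2)%N
     + r j * c (j + 1)%N * r (j + 2)%N + r j * r (j + 1)%N * c (j + 2)%N) + s)
      0 (iota 0 5).

Definition rigid_at (v w : seq int) :=
  if all (fun k => 0 <= paramN (cyc v) (cyc w) k) (iota 0 5) then
    if all (fun k => 0 <= ham_resN (cyc v) (cyc w) (paramN (cyc v) (cyc w)) k)
         (iota 0 5)
    then (w == [:: 0; 0; 0; 0; 0]) && (v \in map chamber_pt (iota 0 3))
    else true
  else true.

Lemma rigid_box : all (fun v => all (fun r0 => all (fun r1 => all (fun r2 =>
  all (fun r3 => rigid_at v [:: r0; r1; r2; r3; - (r0 + r1 + r2 + r3)])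
  box) box) box) box) infty_types.
Proof. by vm_compute. Qed.

(** For fixed leading coefficients the parameters are affine in [r]; their nonnegativity, with the
    sum of [r] equal to 0, bounds [r] and makes the search in [rigid_box] finite. *)
Lemma infty_box (r0 r1 r2 r3 r4 : int) v : v \in infty_types ->
  r0 + r1 + r2 + r3 + r4 = 0 ->
  all (fun k => 0 <= paramN (cyc v) (cyc [:: r0; r1; r2; r3; r4]) k) (iota 0 5) ->
  [&& r0 \in box, r1 \in box, r2 \in box & r3 \in box].
Proof.
rewrite /= andbT /paramN /altN /cyc /= !inE => + e.
by case/or4P=> /eqP-> /=; rewrite /modn /=; lia.
Qed.

(** [C] and [X] carry the factor 15 and [r] does not. The inequalities are unaffected, since
    [infty_param] is linear in [c] and [ham_res] is linear in the pair of [c] and [a]. *)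
Lemma chamber_rigid (C r X : 'I_5 -> int) i v : v \in infty_types ->
  (forall k, C (sh i k) = cyc v k) -> \sum_j r j = 0 ->
  (forall j, X j = infty_param C r j) -> (forall j, 0 <= X j) ->
  (forall k, 0 <= ham_res C r X k) ->
  (forall j, r j = 0) /\ exists2 m, (m < 3)%N & v = chamber_pt m.
Proof.
move=> vT eC; rewrite (sum_sh _ i) => sr eX X0 M0.
pose w := [:: r i; r (sh i 1); r (sh i 2); r (sh i 3); r (sh i 4)].
have er : forall k, r (sh i k) = cyc w k by apply: cyc_ext.
have eXN k : X (sh i k) = paramN (cyc v) (cyc w) k.
  by rewrite eX /infty_param /alt !sh_sh !eC !er.
have eM k : ham_res C r X (sh i k) =
    ham_resN (cyc v) (cyc w) (paramN (cyc v) (cyc w)) k.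
  have C0 : C i = cyc v 0 by rewrite -eC sh0.
  have r0 : r i = cyc w 0 by rewrite -er sh0.
  rewrite /ham_res /ham_resN (sum_sh _ i) !sh_sh !eXN !eC !er C0 r0.
  by congr (_ + _); rewrite /= !addr0 !addrA.
have pX : all (fun k => 0 <= paramN (cyc v) (cyc w) k) (iota 0 5).
  by apply/allP => k _; rewrite -eXN.
have pM : all (fun k => 0 <= ham_resN (cyc v) (cyc w)
    (paramN (cyc v) (cyc w)) k) (iota 0 5).
  by apply/allP => k _; rewrite -eM.
have /and4P[b0 b1 b2 b3] := infty_box vT sr pX.
have := allP (allP (allP (allP (allP rigid_box v vT) _ b0) _ b1) _ b2) _ b3.
have -> : - (r i + r (sh i 1) + r (sh i 2) + r (sh i 3)) = r (sh i 4) by lia.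
rewrite -/w /rigid_at pX pM => /andP[/eqP w0 /mapP[m + ->]].
rewrite mem_iota => m3; split; last by exists m.
move=> j; have [k k5 ->] := sh_sub i j; rewrite er w0 /cyc.
by case: (k %% 5)%N => [|[|[|[|[|l]]]]] //=; rewrite nth_nil.
Qed.

(** * Possible leading coefficients *)

Definition pole_types : seq (seq int) :=
  [:: [:: 1; -1; 0; 0; 0]; [:: -1; 0; 1; 0; 0]; [:: 3; 1; -1; -3; 0]].

Section RealClassification.
Variable F : realFieldType.
Implicit Types (x : 'I_5 -> F) (b : 'I_5 -> bool).

Let pattern (B : seq (seq int)) (d : F) x :=
  exists i, exists2 v, v \in B & forall k, x (sh i k) = (cyc v k)%:~R / d.

(** The mask [b] records which factor of [x_j (A x)_j] vanishes. It splits the quadratic system into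
    32 linear ones, each with only the trivial solution. *)
Lemma real_homog b x : \sum_j x j = 0 ->
  (forall j, if b j then x j = 0 else alt x j = 0) -> forall j, x j = 0.
Proof.
set o : 'I_5 := ord0; rewrite (sum_sh _ o) => s H.
move: (H o) (H (sh o 1)) (H (sh o 2)) (H (sh o 3)) (H (sh o 4)).
rewrite /alt !shE => h0 h1 h2 h3 h4; apply: (@sh_ind o);
move: h0 h1 h2 h3 h4; do 5![case: ifP => _]; lra.
Qed.

Lemma pattern_ext (B : seq (seq int)) (d : F) x i v :
  v \in B ->
  [/\ x i = (v`_0)%:~R / d, x (sh i 1) = (v`_1)%:~R / d,
      x (sh i 2) = (v`_2)%:~R / d, x (sh i 3) = (v`_3)%:~R / d
    & x (sh i 4) = (v`_4)%:~R / d] -> pattern B d x.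
Proof.
move=> vB [e0 e1 e2 e3 e4]; exists i; exists v => // k; rewrite -shM -cycM.
have := mod5_iota k; rewrite !inE => /or4P[|||/orP[]] /eqP-> //.
by rewrite sh0.
Qed.

(** [fit] tries all rotations of all listed vectors; [lra] solves the linear system of the current
    mask. *)
Ltac fit_at i B :=
  let B' := eval unfold B in B in
  let rec loop l :=
    lazymatch l with
    | ?v :: ?l' =>
      first [apply: (@pattern_ext _ _ _ i v); [by [] |];
               rewrite /=; do ?rewrite shE; split; lra | loop l']
    end in loop B'.
Ltac fit B o :=
  first [fit_at o B | fit_at (sh o 1) B | fit_at (sh o 2) B
        | fit_at (sh o 3) B | fit_at (sh o 4) B].

Lemma real_infty b x : \sum_j x j = 1 ->
  (forall j, if b j then x j = 0 else alt x j = 0) ->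
  pattern infty_types 15 x.
Proof.
set o : 'I_5 := ord0; rewrite (sum_sh _ o) => s H.
move: (H o) (H (sh o 1)) (H (sh o 2)) (H (sh o 3)) (H (sh o 4)).
rewrite /alt !shE; do 5![case: ifP => _] => h0 h1 h2 h3 h4.
all: first [exfalso; lra | fit infty_types o].
Qed.

Lemma real_pole b x : \sum_j x j = 0 ->
  (forall j, if b j then x j = 0 else alt x j + 1 = 0) ->
  (forall j, x j = 0) \/ pattern pole_types 1 x.
Proof.
set o : 'I_5 := ord0; rewrite (sum_sh _ o) => s H.
move: (H o) (H (sh o 1)) (H (sh o 2)) (H (sh o 3)) (H (sh o 4)).
rewrite /alt !shE; do 5![case: ifP => _] => h0 h1 h2 h3 h4.
all: first [exfalso; lra | left; apply: (@sh_ind o); lra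
           | right; fit pole_types o].
Qed.

End RealClassification.

Section ComplexClassification.
Variable R : realType.
Local Notation C := (Cx R).
Implicit Types (c d : 'I_5 -> C) (b : 'I_5 -> bool).

Lemma alt_morph (U V : zmodType) (h : {additive U -> V}) (c : 'I_5 -> U) j :
  h (alt c j) = alt (h \o c) j.
Proof. by rewrite /alt !(raddfB, raddfD). Qed.

Lemma Re_zmod_morphism : zmod_morphism (@complex.Re R : C -> R).
Proof. by case=> x y [z t]. Qed.
Lemma Im_zmod_morphism : zmod_morphism (@complex.Im R : C -> R).
Proof. by case=> x y [z t]. Qed.

HB.instance Definition _ :=
  GRing.isZmodMorphism.Build C R (@complex.Re R) Re_zmod_morphism.
HB.instance Definition _ :=
  GRing.isZmodMorphism.Build C R (@complex.Im R) Im_zmod_morphism.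

Let Rp : {additive C -> R} := @complex.Re R.
Let Ip : {additive C -> R} := @complex.Im R.

Lemma Re_Im_eq (x y : C) : Rp x = Rp y -> Ip x = Ip y -> x = y.
Proof. by case: x y => x1 x2 [y1 y2] /= -> ->. Qed.

Lemma sum_morph (h : {additive C -> R}) c : \sum_j (h \o c) j = h (\sum_j c j).
Proof. by rewrite raddf_sum. Qed.

Lemma mask_morph (h : {additive C -> R}) b c :
  (forall j, if b j then c j = 0 else alt c j = 0) ->
  forall j, if b j then (h \o c) j = 0 else alt (h \o c) j = 0.
Proof.
move=> H j; have := H j; case: (b j) => [/= ->|]; first by rewrite raddf0.
by rewrite -alt_morph => ->; rewrite raddf0.
Qed.

Lemma complex_homog b c : \sum_j c j = 0 ->
  (forall j, if b j then c j = 0 else alt c j = 0) -> forall j, c j = 0.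
Proof.
move=> s H j; apply: Re_Im_eq; rewrite raddf0.
  by apply: (@real_homog _ b (Rp \o c)) (mask_morph _ H) j; rewrite sum_morph s raddf0.
by apply: (@real_homog _ b (Ip \o c)) (mask_morph _ H) j; rewrite sum_morph s raddf0.
Qed.

Lemma mask_of_mul c (e : 'I_5 -> C) : (forall j, c j * e j = 0) ->
  forall j, if c j == 0 then c j = 0 else e j = 0.
Proof.
by move=> H j; case: eqP => // /eqP c0; apply: (mulfI c0); rewrite mulr0.
Qed.

(** This excludes both multiple poles and growth faster than [t] at infinity: in each case the top
    coefficients would be a nonzero solution of this system. *)
Lemma alt_homog c : \sum_j c j = 0 -> (forall j, c j * alt c j = 0) ->
  forall j, c j = 0.
Proof. by move=> s /mask_of_mul/(complex_homog s). Qed.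

Lemma Re_int_div (z : int) (n : nat) :
  Rp (z%:~R / n%:R) = z%:~R / n%:R /\ Ip (z%:~R / n%:R) = 0.
Proof.
have -> : z%:~R / n%:R = ((z%:~R / n%:R)%:C)%C :> C.
  by rewrite rmorphM fmorphV rmorph_int rmorph_nat.
by [].
Qed.

(** Real and imaginary parts obey the linear system of the mask of [c]. The imaginary part has sum
    0, so it vanishes, and the real classification applies. *)
Lemma infty_classify c : \sum_j c j = 1 -> (forall j, c j * alt c j = 0) ->
  exists i, exists2 v, v \in infty_types &
    forall k, c (sh i k) = (cyc v k)%:~R / 15.
Proof.
move=> s /mask_of_mul H.
have sR : \sum_j (Rp \o c) j = 1 by rewrite sum_morph s.
have sI : \sum_j (Ip \o c) j = 0 by rewrite sum_morph s.
have [i [v vT e]] := real_infty sR (mask_morph _ H).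
exists i; exists v => // k.
have [eR eI] := Re_int_div (cyc v k) 15.
apply: Re_Im_eq; first by rewrite eR -e.
by rewrite eI; apply: (real_homog sI (mask_morph Ip H)).
Qed.

Lemma pole_classify c : \sum_j c j = 0 ->
  (forall j, c j * (alt c j + 1) = 0) ->
  (forall j, c j = 0) \/ exists i, exists2 v, v \in pole_types &
    forall k, c (sh i k) = (cyc v k)%:~R.
Proof.
move=> s /mask_of_mul H.
have sR : \sum_j (Rp \o c) j = 0 by rewrite sum_morph s.
have sI : \sum_j (Ip \o c) j = 0 by rewrite sum_morph s.
(* The shift by 1 is real, so the imaginary part solves the homogeneous system. *)
have cI : forall j, (Ip \o c) j = 0.
  apply: (real_homog (b := fun j => c j == 0) sI) => j.
  have := H j; case: ifP => [_ /= ->|_]; first by rewrite raddf0.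
  by rewrite -alt_morph => /eqP; rewrite addr_eq0 => /eqP->; rewrite raddfN /= oppr0.
have [|c0|[i [v vT e]]] := real_pole (b := fun j => c j == 0) sR.
- move=> j; have := H j; case: ifP => [_ /= ->|_]; first by rewrite raddf0.
  by rewrite -alt_morph => /eqP; rewrite addr_eq0 => /eqP->; rewrite raddfN /= addNr.
- by left=> j; apply: Re_Im_eq; rewrite raddf0; [exact: c0 | exact: cI].
- right; exists i; exists v => // k; rewrite -[RHS]divr1.
  have [eR eI] := Re_int_div (cyc v k) 1.
  by apply: Re_Im_eq; [rewrite eR -e | rewrite eI; exact: cI].
Qed.

Lemma infty_alt_neq0 c : \sum_j c j = 1 -> (forall j, c j * alt c j = 0) ->
  forall j, c j = 0 -> alt c j != 0.
Proof.
move=> s H j; have [i [v vT e]] := infty_classify s H.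
have [k k5 ->] := sh_sub i j; rewrite e /alt !sh_sh !e => /eqP.
have fifteen_neq0 : 15 != 0 :> C by rewrite pnatr_eq0.
rewrite mulf_eq0 invr_eq0 (negPf fifteen_neq0) orbF intr_eq0 => cv.
rewrite -!mulrBl -mulrDl -mulrBl mulf_neq0 ?invr_eq0 //.
rewrite -!intrB -intrD -intrB intr_eq0.
have chk : all (fun v => all (fun k => (cyc v k == 0) ==> (altN (cyc v) k != 0))
   (iota 0 5)) infty_types by vm_compute.
have kI : k \in iota 0 5 by rewrite mem_iota.
exact: (implyP (allP (allP chk v vT) k kI)).
Qed.

(** The quadratic system linearised at [c]. Where [c_j = 0], [(A c)_j] is nonzero and forces
    [d_j = 0]; elsewhere [(A c)_j = 0] and so [(A d)_j = 0]. Thus [d] solves a masked homogeneous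
    system. *)
Lemma infty_lin c d : \sum_j c j = 1 -> (forall j, c j * alt c j = 0) ->
  \sum_j d j = 0 -> (forall j, c j * alt d j + d j * alt c j = 0) ->
  forall j, d j = 0.
Proof.
move=> s H sd Hd; apply: (complex_homog (b := fun j => c j == 0) sd) => j.
case: eqP => [c0|/eqP c0]; have := Hd j.
  rewrite c0 mul0r add0r => /eqP; rewrite mulf_eq0.
  by rewrite (negPf (infty_alt_neq0 s H c0)) orbF => /eqP.
have -> : alt c j = 0 by apply: (mulfI c0); rewrite mulr0.
by rewrite mulr0 addr0 => e; apply: (mulfI c0); rewrite mulr0.
Qed.

End ComplexClassification.

(** * The cubic Hamiltonians *)

Section Hamiltonian.
Variable V : comNzRingType.
Implicit Types (c r a n t : 'I_5 -> V).

Definition cubic n := \sum_j n j * n (sh j 1) * n (sh j 2).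

(** The part of [cubic (c + r)] of degree one in [c] and two in [r]. *)
Definition cubic_polar c r :=
  \sum_j (c j * r (sh j 1) * r (sh j 2) + r j * c (sh j 1) * r (sh j 2)
          + r j * r (sh j 1) * c (sh j 2)).

(* The partial derivative of [cubic] with respect to [n_k]. *)
Definition cubic_grad n k :=
  n (sh k 1) * n (sh k 2) + n (sh k 4) * n (sh k 1) + n (sh k 3) * n (sh k 4).

(* The linear part [sum_j beta_j n_j] of the k-th Hamiltonian: [beta] solves
   [beta_(j-1) - beta_(j+1) = a_j - delta_(j,k)] with [beta_k = 0]. *)
Definition ham_lin a k n :=
  (a (sh k 2) + a (sh k 4)) * n (sh k 1) - a (sh k 1) * n (sh k 2)
  + a (sh k 4) * n (sh k 3) - (a (sh k 1) + a (sh k 3)) * n (sh k 4).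

Lemma ham_resE c r a k : ham_res c r a k = ham_lin a k r + cubic_polar c r.
Proof. by []. Qed.

(* With [n = f D], this is [h_k' = cubic_grad f k] multiplied by [D ^+ 4]. *)
Lemma ham_deriv_identity a n n' (D D' : V) k :
  \sum_j a j = 1 ->
  (forall j, n' j * D - n j * D' = n j * alt n j + a j * D ^+ 2) ->
  (\sum_j (n' j * n (sh j 1) * n (sh j 2) + n j * n' (sh j 1) * n (sh j 2)
     + n j * n (sh j 1) * n' (sh j 2))
   + (2 * D' * D * ham_lin a k n + D ^+ 2 * ham_lin a k n')) * D
  - 3 * (cubic n + D ^+ 2 * ham_lin a k n) * D' = D ^+ 2 * cubic_grad n k.
Proof.
move=> sa e.
have e0 := e k; have e1 := e (sh k 1); have e2 := e (sh k 2).
have e3 := e (sh k 3); have e4 := e (sh k 4).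
move: sa e0 e1 e2 e3 e4; rewrite /cubic /cubic_grad /ham_lin /alt.
rewrite !(sum_sh _ k) !shE; clear e.
move: (n k) (n (sh k 1)) (n (sh k 2)) (n (sh k 3)) (n (sh k 4)).
move=> n0 n1 n2 n3 n4.
move: (n' k) (n' (sh k 1)) (n' (sh k 2)) (n' (sh k 3)) (n' (sh k 4)).
move=> m0 m1 m2 m3 m4.
move: (a k) (a (sh k 1)) (a (sh k 2)) (a (sh k 3)) (a (sh k 4)).
move=> a0 a1 a2 a3 a4 sa.
have -> : a0 = 1 - a1 - a2 - a3 - a4 by rewrite -sa; ring.
move=> /eqP; rewrite -subr_eq0 => /eqP e0.
move=> /eqP; rewrite -subr_eq0 => /eqP e1.
move=> /eqP; rewrite -subr_eq0 => /eqP e2.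
move=> /eqP; rewrite -subr_eq0 => /eqP e3.
move=> /eqP; rewrite -subr_eq0 => /eqP e4.
(* The difference of the two sides is the sum over [j] of the [j]-th equation
   times the [j]-th partial derivative of the Hamiltonian. *)
apply/eqP; rewrite -subr_eq0; apply/eqP.
rewrite -[RHS](_ : (n1 * n2 + n4 * n1 + n3 * n4) * 0
 + (n2 * n3 + n0 * n2 + n4 * n0 + (a2 + a4) * D ^+ 2) * 0
 + (n3 * n4 + n1 * n3 + n0 * n1 - a1 * D ^+ 2) * 0
 + (n4 * n0 + n2 * n4 + n1 * n2 + a4 * D ^+ 2) * 0
 + (n0 * n1 + n3 * n0 + n2 * n3 - (a1 + a3) * D ^+ 2) * 0 = 0);
  last by ring.
by rewrite -{1}e0 -{1}e1 -{1}e2 -{1}e3 -{1}e4; ring.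
Qed.

Lemma cubic_expand c t (x : V) : (forall j, c j * alt c j = 0) ->
  \sum_j t j = 0 ->
  cubic (fun j => c j * x + t j)
  = cubic c * x ^+ 3 + x * cubic_polar c t + cubic t.
Proof.
move=> e st; pose k : 'I_5 := ord0.
have e0 := e k; have e1 := e (sh k 1); have e3 := e (sh k 3).
have e4 := e (sh k 4).
move: st e0 e1 e3 e4; rewrite /cubic /cubic_polar /alt.
rewrite !(sum_sh _ k) !shE; clear e.
move: (c k) (c (sh k 1)) (c (sh k 2)) (c (sh k 3)) (c (sh k 4)).
move=> c0 c1 c2 c3 c4.
move: (t k) (t (sh k 1)) (t (sh k 2)) (t (sh k 3)) (t (sh k 4)).
move=> t0 t1 t2 t3 t4 st e0 e1 e3 e4.
have -> : t4 = - t0 - t1 - t2 - t3 by rewrite -[LHS]subr0 -st; ring.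
(* All partial derivatives of [cubic] agree at [c], so the term linear in [t]
   is a multiple of [sum_j t_j]. *)
apply/eqP; rewrite -subr_eq0; apply/eqP.
rewrite -[RHS](_ : x ^+ 2 * (t0 * (0 + 0) - t1 * 0 + t2 * 0
  + t3 * (0 + 0 + 0)) = 0); last by ring.
rewrite -{1}e1 -{1}e3 -{1}e0 -{1}e3 -{1}e4 -{1}e1 -{1}e3; ring.
Qed.

Lemma cubic_scale (x : V) n : cubic (fun j => x * n j) = x ^+ 3 * cubic n.
Proof. by rewrite /cubic mulr_sumr; apply: eq_bigr => j _; ring. Qed.

Lemma cubic_polar_scale (x : V) c n :
  cubic_polar c (fun j => x * n j) = x ^+ 2 * cubic_polar c n.
Proof. by rewrite /cubic_polar mulr_sumr; apply: eq_bigr => j _; ring. Qed.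

Lemma ham_lin_scale (x : V) a k n :
  ham_lin a k (fun j => x * n j) = x * ham_lin a k n.
Proof. by rewrite /ham_lin; ring. Qed.

End Hamiltonian.

(** * Polynomial form of a rational solution *)

Section PolyLemmas.
Variable K : fieldType.
Implicit Types (p q T : {poly K}) (s : seq K).

Lemma coef_top_mul p q a b : (size p <= a.+1)%N -> (size q <= b.+1)%N ->
  (p * q)`_(a + b) = p`_a * q`_b.
Proof.
move=> sp sq; rewrite coefM.
have aI : (a < (a + b).+1)%N by rewrite ltnS leq_addr.
rewrite (bigD1 (Ordinal aI)) //= addKn big1 ?addr0 // => i ia.
have [ai|ia'] := ltnP a i.
  by rewrite nth_default ?mul0r // (leq_trans sp).
have {}ia : (i < a)%N by rewrite ltn_neqAle ia' andbT.
rewrite [q`_(_)]nth_default ?mulr0 // (leq_trans sq) //; lia.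
Qed.

Lemma coef_default p k : (size p <= k)%N -> p`_k = 0.
Proof. exact: nth_default. Qed.

Lemma coef_lin (x y : K) p q k : (x%:P * p + q * y%:P)`_k = x * p`_k + q`_k * y.
Proof. by rewrite coefD coefCM coefMC. Qed.

Lemma size_lin (x y : K) p q k : (size p <= k)%N -> (size q <= k)%N ->
  (size (x%:P * p + q * y%:P)%R <= k)%N.
Proof.
move=> sp sq; rewrite (leq_trans (size_polyD _ _)) // geq_max.
by rewrite [q * _]mulrC !mul_polyC !(leq_trans (size_scale_leq _ _)).
Qed.

Lemma size_mul_bound p q a b : (size p <= a.+1)%N -> (size q <= b.+1)%N ->
  (size (p * q)%R <= (a + b).+1)%N.
Proof. by move=> sp sq; apply: leq_trans (size_polyMleq _ _) _; lia. Qed.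

Lemma size_le_sub T n : (size T <= n.+1)%N -> T`_n = 0 -> (size T <= n)%N.
Proof.
move=> sT T0; apply/leq_sizeP => j; rewrite leq_eqVlt => /orP[/eqP <-//|nj].
by rewrite nth_default // (leq_trans sT).
Qed.

(** A formal leading coefficient: [x] may be 0, so sums and products need no case distinction on
    cancellation. *)
Definition top_coef k p (x : K) := (size p <= k.+1)%N /\ p`_k = x.

Lemma top_coefM a b p q x y : top_coef a p x -> top_coef b q y ->
  top_coef (a + b) (p * q) (x * y).
Proof.
by case=> sp <- [sq <-]; split; [apply: size_mul_bound | apply: coef_top_mul].
Qed.

Lemma top_coefD k p q x y : top_coef k p x -> top_coef k q y ->
  top_coef k (p + q) (x + y).
Proof.
case=> sp <- [sq <-]; split; last by rewrite coefD.
by rewrite (leq_trans (size_polyD _ _)) // geq_max sp sq.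
Qed.

Lemma top_coefB k p q x y : top_coef k p x -> top_coef k q y ->
  top_coef k (p - q) (x - y).
Proof.
case=> sp <- [sq <-]; split; last by rewrite coefB.
by rewrite (leq_trans (size_polyD _ _)) // size_polyN geq_max sp sq.
Qed.

Lemma top_coefC (x : K) : top_coef 0 x%:P x.
Proof. by split; rewrite ?coefC // size_polyC_leq1. Qed.

Lemma top_coef_sum k (I : finType) (P : I -> {poly K}) (x : I -> K) :
  (forall i, top_coef k (P i) (x i)) -> top_coef k (\sum_i P i) (\sum_i x i).
Proof.
move=> H; apply: (big_ind2 (top_coef k)) => [|q u q' u'|i _ //].
  by split; rewrite ?coef0 ?size_poly0.
exact: top_coefD.
Qed.

(** The coefficient of 1/t of [T / D] at infinity is the sum of its residues. The factor ['X] avoids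
    the index [size s - 1], which would be truncated for empty [s]. *)
Lemma lagrange_top s T : uniq s -> (size T <= size s)%N ->
  let D := \prod_(x <- s) ('X - x%:P) in
  ('X * T)`_(size s) = \sum_(p <- s) T.[p] / D^`().[p].
Proof.
elim: s T => [|x s IHs] T /=.
  move=> _; rewrite leqn0 size_poly_eq0 => /eqP ->.
  by rewrite mulr0 coef0 big_nil.
move=> /andP[xs us] sT; rewrite !big_cons.
set E := \prod_(y <- s) ('X - y%:P).
have E0 y : y \in s -> E.[y] = 0.
  by move=> ys; apply/rootP; rewrite root_prod_XsubC.
have Ex : E.[x] != 0 by rewrite -rootE root_prod_XsubC.
have sE : size E = (size s).+1 by rewrite size_prod_XsubC.
have mE : E`_(size s) = 1.
  have /monicP : E \is monic by apply: monic_prod_XsubC.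
  by rewrite lead_coefE sE.
have dE y : (('X - x%:P) * E)^`().[y] = E.[y] + (y - x) * E^`().[y].
  by rewrite derivM derivXsubC mul1r hornerD hornerM hornerXsubC.
(* The residue of [T / D] at [x]; [T - a *: E] vanishes there, which leaves a quotient [S] over the
   remaining roots. *)
pose a := T.[x] / E.[x].
have : root (T - a *: E) x.
  by rewrite rootE !hornerE /a divfK // subrr.
rewrite -dvdp_XsubCl => /dvdpP[S eS].
have eT : T = S * ('X - x%:P) + a *: E by rewrite -eS addrNK.
have sS : (size S <= size s)%N.
  have [->|S0] := eqVneq S 0; first by rewrite size_poly0.
  have : (size (S * ('X - x%:P))%R <= (size s).+1)%N.
    rewrite -eS (leq_trans (size_polyD _ _)) // geq_max sT size_polyN.
    by rewrite (leq_trans (size_scale_leq _ _)) ?sE.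
  by rewrite size_Mmonic ?monicXsubC // size_XsubC addn2.
have cT : ('X * T)`_(size s).+1 = a + ('X * S)`_(size s).
  rewrite coefXM /= {1}eT coefD coefZ mE mulr1 addrC; congr (_ + _).
  rewrite mulrBr.
  have -> : S * 'X - S * x%:P = 'X * S - x *: S.
    by rewrite mulrC [S * x%:P]mulrC mul_polyC.
  by rewrite coefB coefZ [S`__]nth_default ?mulr0 ?subr0.
rewrite cT IHs // dE subrr mul0r addr0; congr (_ + _).
apply: eq_big_seq => y ys; rewrite dE E0 // add0r eT.
rewrite !hornerE E0 // mulr0 addr0.
have yx : y - x != 0 by rewrite subr_eq0; apply: contraNneq xs => <-.
by rewrite [(y - x) * _]mulrC -mulf_div divff // mulr1.
Qed.

End PolyLemmas.

Lemma alt_affine (V : comNzRingType) (c t : 'I_5 -> V) (x : V) j :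
  alt (fun i => c i * x + t i) j = alt c j * x + alt t j.
Proof. by rewrite /alt; ring. Qed.

Lemma cubic_grad_scale (F : fieldType) (x : 'I_5 -> F) (e : F) k :
  cubic_grad (fun j => x j / e) k = cubic_grad x k / e ^+ 2.
Proof. by rewrite /cubic_grad -exprVn; ring. Qed.

(** Equation for the remainder [t] once the linear part [c * (x * D)] is subtracted: the square of
    that part drops out because [c * ac = 0]. *)
Lemma wronskian_affine (V : comNzRingType) (c at_ ac t x D t' D' al : V) :
  c * ac = 0 ->
  (c * (1 * D + x * D') + t') * D - (c * (x * D) + t) * D'
    = (c * (x * D) + t) * (ac * (x * D) + at_) + al * D ^+ 2 ->
  t' * D - t * D' = x * D * (c * at_ + t * ac) + t * at_ + (al - c) * D ^+ 2.
Proof.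
move=> e; have -> : c * (1 * D + x * D') + t' = c * D + (c * x * D' + t') by ring.
move=> /eqP; rewrite -subr_eq0 => /eqP h.
apply/eqP; rewrite -subr_eq0; apply/eqP.
rewrite -[RHS](_ : 0 + 0 * (x * D) ^+ 2 = 0); last by ring.
by rewrite -{1}h -e; ring.
Qed.

Section PolynomialForm.
Variable R : realType.
Local Notation C := (Cx R).
Variables (a : 'I_5 -> C) (N : 'I_5 -> {poly C}) (D : {poly C}).
Hypothesis suma : \sum_j a j = 1.
Hypothesis Dmonic : D \is monic.
Hypothesis eqN : forall j,
  (N j)^`() * D - N j * D^`() = N j * alt N j + (a j)%:P * D ^+ 2.
Hypothesis sumN : \sum_j N j = 'X * D.
Hypothesis reduced : forall p, root D p -> exists j, ~~ root (N j) p.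

Lemma alt_horner (T : 'I_5 -> {poly C}) p j :
  (alt T j).[p] = alt (fun i => (T i).[p]) j.
Proof. by rewrite /alt !hornerE. Qed.

Lemma alt_coef (T : 'I_5 -> {poly C}) k j :
  (alt T j)`_k = alt (fun i => (T i)`_k) j.
Proof. by rewrite /alt !(coefB, coefD). Qed.

Lemma alt_size (T : 'I_5 -> {poly C}) m j :
  (forall i, (size (T i) <= m)%N) -> (size (alt T j) <= m)%N.
Proof.
move=> sT; rewrite /alt.
do ![rewrite (leq_trans (size_polyD _ _)) // geq_max ?size_polyN ?sT ?andbT //].
Qed.

(** At a multiple root the equation reduces to [N_j (A N)_j = 0] with the sum of the [N_j] equal to
    0. By [alt_homog] all numerators vanish there, against [reduced]. *)
Lemma simple_root p : root D p -> D^`().[p] != 0.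
Proof.
move=> Dp; apply/eqP => D'p; have /rootP Dp0 := Dp.
have [j] := reduced Dp; rewrite rootE => /eqP; apply.
apply: (@alt_homog _ (fun i => (N i).[p])) j => [|j].
  by rewrite -horner_sum sumN hornerM Dp0 mulr0.
have := congr1 (horner^~ p) (eqN j).
rewrite /= [RHS]hornerD [in RHS]hornerM alt_horner !hornerE Dp0 D'p.
by rewrite !mulr0 subr0 [X in _ + X]mulr0 addr0 => <-.
Qed.

Lemma coprime_deriv : coprimep D D^`().
Proof. by apply: Pdiv.ClosedField.root_coprimep => p /simple_root. Qed.

Lemma monic_split : exists s, D = \prod_(p <- s) ('X - p%:P) /\ uniq s.
Proof.
have [s eD] := closed_field_poly_normal D.
rewrite (monicP Dmonic) scale1r in eD; exists s; split=> //.
rewrite -separable_prod_XsubC -eD unlock.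
exact: coprime_deriv.
Qed.

Variables (s : seq C).
Hypothesis splitD : D = \prod_(p <- s) ('X - p%:P).
Hypothesis uniqs : uniq s.
Let n := size s.

Lemma rootD p : root D p = (p \in s).
Proof. by rewrite splitD root_prod_XsubC. Qed.

Lemma sizeD : size D = n.+1.
Proof. by rewrite splitD size_prod_XsubC. Qed.

Lemma coefD_top : D`_n = 1.
Proof. by have /monicP := Dmonic; rewrite lead_coefE sizeD. Qed.

Lemma size_sqrD : (size (D ^+ 2) <= (n + n).+1)%N.
Proof. by rewrite expr2 size_mul_bound ?sizeD. Qed.

Lemma coef_sqrD : (D ^+ 2)`_(n + n) = 1.
Proof. by rewrite expr2 coef_top_mul ?sizeD // coefD_top mulr1. Qed.

Lemma size_deriv_bound (T : {poly C}) m :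
  (size T <= m.+1)%N -> (size T^`() <= m)%N.
Proof.
have [->|T0] := eqVneq T 0; first by rewrite linear0 size_poly0.
by move=> sT; rewrite -ltnS (leq_trans (lt_size_deriv T0)).
Qed.

Lemma size_wronskian (T : {poly C}) m : (size T <= m.+1)%N ->
  (size (T^`() * D - T * D^`())%R <= m + n)%N.
Proof.
move=> sT; have [->|T0] := eqVneq T 0.
  by rewrite linear0 !mul0r subr0 size_poly0.
have sT' := size_deriv_bound sT; have sD' : (size D^`() <= n)%N.
  by rewrite size_deriv_bound ?sizeD.
rewrite (leq_trans (size_polyD _ _)) // geq_max size_polyN.
apply/andP; split; apply: leq_trans (size_polyMleq _ _) _.
  by rewrite sizeD addnS /= leq_add2r.
by rewrite -subn1 leq_subLR add1n -addSn leq_add.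
Qed.

(** Beyond linear growth the quadratic term dominates the derivative, the constant and the sum
    condition, so [alt_homog] kills the top coefficients. The excess degree is removed one unit at a
    time. *)
Lemma sizeN_aux m : (forall j, (size (N j) <= (n + m).+2)%N) ->
  forall j, (size (N j) <= n.+2)%N.
Proof.
elim: m => [|m IHm]; first by rewrite addn0.
move=> sN; apply: IHm => j; pose M := (n + m).+2.
have {}sN i : (size (N i) <= M.+1)%N by rewrite /M -addnS.
rewrite -/M; apply: size_le_sub => //.
apply: (@alt_homog _ (fun i => (N i)`_M)) j => [|j].
  rewrite -coef_sum sumN coefXM /M /= nth_default // sizeD.
  by rewrite ltnS leq_addr.
have := congr1 (fun q : {poly C} => q`_(M + M)) (eqN j).
rewrite [RHS]coefD coef_top_mul ?alt_size // alt_coef mul_polyC coefZ.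
have nM : (n < M)%N by rewrite /M ltnS -addnS leq_addr.
rewrite (@coef_default _ (_ - _)); last first.
  by rewrite (leq_trans (size_wronskian (sN j))) // leq_add2l ltnW.
rewrite (@coef_default _ (D ^+ 2)) ?mulr0 ?addr0 => [<-//|].
by rewrite (leq_trans size_sqrD) // -addSn leq_add // ltnW.
Qed.

Lemma sizeN j : (size (N j) <= n.+2)%N.
Proof.
pose m := \max_i size (N i); apply: (@sizeN_aux m) => i.
have sm : (size (N i) <= m)%N := leq_bigmax i.
by rewrite (leq_trans sm) // -addSn -addSn leq_addl.
Qed.

(** Here [f_j = c_j t + T_j / D]; [d] and [r] below are the coefficients of order 0 and -1 in
    [t]. *)
Let c j := (N j)`_n.+1.
Let T j := N j - (c j)%:P * ('X * D).

Lemma sizeXD : (size ('X * D)%R <= n.+2)%N.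
Proof. by rewrite mulrC size_mulX ?sizeD // monic_neq0. Qed.

Lemma coefXD : ('X * D)`_n.+1 = 1.
Proof. by rewrite coefXM coefD_top. Qed.

Lemma sumc : \sum_j c j = 1.
Proof. by rewrite -coef_sum sumN coefXD. Qed.

Lemma altc j : c j * alt c j = 0.
Proof.
have := congr1 (fun q : {poly C} => q`_(n.+1 + n.+1)) (eqN j).
rewrite [RHS]coefD coef_top_mul ?alt_size ?sizeN //; last by move=> i; apply: sizeN.
rewrite alt_coef mul_polyC coefZ.
rewrite (@coef_default _ (_ - _)); last first.
  by rewrite (leq_trans (size_wronskian (sizeN j))) // leq_add2l.
rewrite (@coef_default _ (D ^+ 2)) ?mulr0 ?addr0 => [<-//|].
by rewrite (leq_trans size_sqrD) // -addSn leq_add.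
Qed.

Lemma sumT : \sum_j T j = 0.
Proof.
by rewrite sumrB -mulr_suml -rmorph_sum sumc mul1r sumN subrr.
Qed.

Lemma sizeT_weak j : (size (T j) <= n.+1)%N.
Proof.
apply: size_le_sub; last by rewrite coefB coefCM coefXD mulr1 subrr.
rewrite (leq_trans (size_polyD _ _)) // geq_max sizeN size_polyN.
by rewrite mul_polyC (leq_trans (size_scale_leq _ _)) ?sizeXD.
Qed.

Lemma eqT j : (T j)^`() * D - T j * D^`() =
  'X * D * ((c j)%:P * alt T j + T j * (alt c j)%:P)
  + T j * alt T j + (a j - c j)%:P * D ^+ 2.
Proof.
have eN i : N i = (c i)%:P * ('X * D) + T i by rewrite addrC subrK.
rewrite [(a j - c j)%:P]polyCB; apply: wronskian_affine.
  by rewrite -polyCM altc polyC0.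
have -> : (alt c j)%:P = alt (fun i => (c i)%:P) j by rewrite /alt !(polyCB, polyCD).
rewrite -alt_affine -eN (_ : alt (fun i => _) j = alt N j); last first.
  by rewrite /alt -!eN.
rewrite -eqN; congr (_ * D - _).
by rewrite [in RHS]eN [RHS]derivD derivM derivC derivM derivX mul0r add0r.
Qed.

Let d j := (T j)`_n.

(** The terms of order [t] in the equation are the system linearised at [c], so [infty_lin]
    applies. *)
Lemma d_eq0 j : d j = 0.
Proof.
apply: (infty_lin sumc altc (d := d)) => [|i]; first by rewrite -coef_sum sumT coef0.
have := congr1 (fun q : {poly C} => q`_(n.+1 + n)) (eqT i).
have sTA : (size (alt T i) <= n.+1)%N by apply: alt_size => k; apply: sizeT_weak.
rewrite 2![in RHS]coefD coef_top_mul ?sizeXD //; last first.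
  by rewrite size_lin ?sizeT_weak.
rewrite coefXD mul1r coef_lin alt_coef -/(d _).
rewrite (@coef_default _ (_ - _)); last first.
  by rewrite (leq_trans (size_wronskian (sizeT_weak i))) // leq_add2r.
rewrite (@coef_default _ (T i * _)); last first.
  by rewrite (leq_trans (size_mul_bound (sizeT_weak i) sTA)).
rewrite mul_polyC coefZ (@coef_default _ (D ^+ 2)) ?(leq_trans size_sqrD) //.
by rewrite mulr0 !addr0 => <-.
Qed.

Lemma sizeT j : (size (T j) <= n)%N.
Proof. by apply: size_le_sub (sizeT_weak j) (d_eq0 j). Qed.

Let r j := ('X * T j)`_n.

Lemma sizeXT j : (size ('X * T j)%R <= n.+1)%N.
Proof. by rewrite (leq_trans (size_polyMleq _ _)) // size_polyX ltnS sizeT. Qed.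

(** Comparison of the constant terms at infinity: the derivative of [T_j / D] and the products of
    two remainders are of order at most -2. *)
Lemma param_infty j : a j = infty_param c r j.
Proof.
have := congr1 (fun q : {poly C} => q`_(n + n)) (eqT j).
have sTA : (size (alt T j) <= n)%N by apply: alt_size => k; apply: sizeT.
rewrite 2![in RHS]coefD [X in _ = _ + X]coefCM coef_sqrD mulr1.
rewrite (@coef_default _ (_ - _)); last first.
  by apply: size_wronskian; apply: leq_trans (sizeT j) (leqnSn n).
rewrite (@coef_default _ (T j * _)); last first.
  rewrite (leq_trans (size_polyMleq _ _)) // (leq_trans (leq_pred _)) //.
  by rewrite leq_add ?sizeT.
(* The factor ['X] moves into [T], so that the top coefficients become the [r_j]. *)
have -> : 'X * D * ((c j)%:P * alt T j + T j * (alt c j)%:P) =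
  D * ((c j)%:P * alt (fun i => 'X * T i) j + 'X * T j * (alt c j)%:P).
  by rewrite /alt; ring.
rewrite coef_top_mul ?sizeD //; last first.
  by apply: size_lin; [apply: alt_size => i|]; apply: sizeXT.
rewrite coefD_top mul1r coef_lin alt_coef -/(r _) addr0.
rewrite /infty_param => /esym/eqP; rewrite addr_eq0 => /eqP e.
by rewrite -[LHS](addrNK (c j)) -[a j - c j]opprK -e; ring.
Qed.

Lemma lagrange_residue (W : {poly C}) : (size W <= n)%N ->
  ('X * W)`_n = \sum_(p <- s) W.[p] / D^`().[p].
Proof. by move=> sW; rewrite (lagrange_top uniqs sW) splitD. Qed.

Let rho p j := (N j).[p] / D^`().[p].

Lemma residue_sum j : r j = \sum_(p <- s) rho p j.
Proof.
rewrite /r lagrange_residue ?sizeT //; apply: eq_big_seq => p.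
by rewrite -rootD => /rootP Dp; rewrite /T hornerD hornerN !hornerM Dp !mulr0 subr0.
Qed.

Lemma rho_sum p : p \in s -> \sum_j rho p j = 0.
Proof.
rewrite -rootD => /rootP Dp.
by rewrite -mulr_suml -horner_sum sumN hornerM Dp mulr0 mul0r.
Qed.

(** The coefficient of the double pole at [p]: the derivative contributes [- rho], the quadratic
    term [rho * alt rho]. *)
Lemma rho_eq p j : p \in s -> rho p j * (alt (rho p) j + 1) = 0.
Proof.
rewrite -rootD => rp; have D'0 := simple_root rp; have /rootP Dp := rp.
have := congr1 (horner^~ p) (eqN j).
rewrite /= [RHS]hornerD [in RHS]hornerM alt_horner !hornerE Dp.
rewrite !mulr0 sub0r [X in _ + X]mulr0 addr0 => e.
have -> : alt (rho p) j = alt (fun i => (N i).[p]) j / D^`().[p].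
  by rewrite /alt /rho -!mulrBl -mulrDl -mulrBl.
apply/eqP; rewrite /rho mulf_eq0 mulf_eq0 invr_eq0 (negPf D'0) orbF.
rewrite -(divff D'0) -mulrDl mulf_eq0 invr_eq0 (negPf D'0) orbF -mulf_eq0.
by rewrite mulrDr -e addNr.
Qed.

Lemma rho_neq0 p : p \in s -> exists j, rho p j != 0.
Proof.
rewrite -rootD => rp; have [j Nj] := reduced rp; exists j.
by rewrite mulf_neq0 ?invr_eq0 ?simple_root.
Qed.




Let A j : {poly C} := (a j)%:P.

Lemma sumA : \sum_j A j = 1.
Proof. by rewrite -rmorph_sum suma. Qed.

Lemma char0_3 : (3 : C) != 0.
Proof. by rewrite pnatr_eq0. Qed.

(* The Hamiltonian has at most simple poles, because its derivative has at most
   double ones. *)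
Lemma ham_quotient k : exists U,
  cubic N + D ^+ 2 * ham_lin A k N = U * D ^+ 2
  /\ U^`() * D - U * D^`() = cubic_grad N k.
Proof.
set P := cubic N + _; have D0 := monic_neq0 Dmonic.
(* The Hamiltonian is [P / D ^+ 3]. Each division below removes one factor [D], which is coprime to
   its derivative. *)
have eP : P^`() * D - 3 * P * D^`() = D ^+ 2 * cubic_grad N k.
  rewrite -(ham_deriv_identity k sumA eqN); congr (_ * D - _).
  rewrite /P derivD; congr (_ + _); first (rewrite /cubic raddf_sum /=).
    by apply: eq_bigr => j _; rewrite !derivM mulrDl.
  rewrite expr2 !derivM /ham_lin !(derivB, derivD, derivM) /A !derivC.
  by ring.
have D3 (Q : {poly C}) : D %| 3 * Q * D^`() -> D %| Q.
  rewrite mulrC Gauss_dvdpr ?coprime_deriv // -polyC_natr mul_polyC.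
  by rewrite dvdpZr ?char0_3.
have /dvdpP[P1 eP1] : D %| P.
  apply: D3; have -> : 3 * P * D^`() = P^`() * D - D ^+ 2 * cubic_grad N k.
    by rewrite -eP; ring.
  by rewrite dvdp_sub ?dvdp_mulIr // expr2 -mulrA dvdp_mulIl.
have eP2 : P1^`() * D - 2 * P1 * D^`() = D * cubic_grad N k.
  apply: (mulfI D0); rewrite mulrA -expr2 -eP eP1 derivM; ring.
have /dvdpP[U eU] : D %| P1.
  have : D %| 2 * P1 * D^`().
    have -> : 2 * P1 * D^`() = P1^`() * D - D * cubic_grad N k.
      by rewrite -eP2; ring.
    by rewrite dvdp_sub ?dvdp_mulIr ?dvdp_mulIl.
  rewrite mulrC Gauss_dvdpr ?coprime_deriv // -polyC_natr mul_polyC.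
  by rewrite dvdpZr // pnatr_eq0.
exists U; split; first by rewrite eP1 eU expr2 mulrA.
by apply: (mulfI D0); rewrite -eP2 eU derivM; ring.
Qed.

(** The residue of the k-th Hamiltonian at a pole with residue vector [z]: its derivative has
    double-pole coefficient [cubic_grad z k], hence the sign. *)
Definition pole_weight (z : 'I_5 -> C) k := - cubic_grad z k.

Let Cc j : {poly C} := (c j)%:P.

Lemma topD : top_coef n D 1.
Proof. by split; rewrite ?sizeD ?coefD_top. Qed.

Lemma topY j : top_coef n ('X * T j) (r j).
Proof. by split=> //; apply: sizeXT. Qed.

Section TopCoef.
Variables (m : nat) (Y : 'I_5 -> {poly C}) (y : 'I_5 -> C).
Hypothesis topY' : forall j, top_coef m (Y j) (y j).

Lemma top_ham_lin k : top_coef m (ham_lin A k Y) (ham_lin a k y).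
Proof.
have tA i l : top_coef m (A i * Y l) (a i * y l).
  exact: (top_coefM (top_coefC (a i)) (topY' l)).
rewrite /ham_lin !mulrDl.
by do ?[exact: tA | apply: top_coefB | apply: top_coefD].
Qed.

Lemma top_polar : top_coef (m + m) (cubic_polar Cc Y) (cubic_polar c y).
Proof.
apply: top_coef_sum => j; do 2?apply: top_coefD.
- exact: (top_coefM (top_coefM (top_coefC (c j)) (topY' (sh j 1))) (topY' (sh j 2))).
- rewrite -{1}[m]addn0.
  exact: (top_coefM (top_coefM (topY' j) (top_coefC (c (sh j 1)))) (topY' (sh j 2))).
- rewrite -[(m + m)%N]addn0.
  exact: (top_coefM (top_coefM (topY' j) (topY' (sh j 1))) (top_coefC (c (sh j 2)))).
Qed.

Lemma top_cubic : top_coef (m + m + m) (cubic Y) (cubic y).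
Proof. by apply: top_coef_sum => j; do 2?apply: top_coefM. Qed.

End TopCoef.

(** The coefficient of 1/t at infinity equals the sum of the residues at the finite poles, which are
    simple by [ham_quotient]. *)
Lemma ham_residue k : ham_res c r a k = \sum_(p <- s) pole_weight (rho p) k.
Proof.
have [U [eU eU']] := ham_quotient k.
(* [V / D] is the Hamiltonian minus its polynomial part, which has terms in [t^3] and [t] only by
   [cubic_expand]. *)
pose V := U - (cubic Cc * 'X ^+ 3 + 'X * ham_lin A k Cc) * D.
have eN : N = fun j => Cc j * ('X * D) + T j.
  by apply/funext => j; rewrite addrC subrK.
have altCc j : Cc j * alt Cc j = 0.
  by rewrite -(rmorph0 (@polyC C)) -(altc j) rmorphM /alt !(rmorphB, rmorphD).
have eV : V * D ^+ 2 = D ^+ 2 * ham_lin A k T + 'X * D * cubic_polar Cc T + cubic T.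
  rewrite mulrBl -eU eN (cubic_expand ('X * D) altCc sumT) /ham_lin; ring.
have topD2 : top_coef (n + n) (D ^+ 2) 1.
  by rewrite expr2 -[1]mulr1; apply: top_coefM topD topD.
have topXD : top_coef n.+1 ('X * D) 1 by split; [exact: sizeXD | exact: coefXD].
have sV : (size V <= n)%N.
  (* Without poles every [T j] is 0; the degree count below needs [n.-1] to be a true
     predecessor. *)
  have [n0|n_gt0] := posnP n.
    have T0 j : T j = 0 by apply/eqP; rewrite -size_poly_leq0 -n0 sizeT.
    rewrite n0 size_poly_leq0 -(mulIr_eq0 _ (mulIf (expf_neq0 2 (monic_neq0 Dmonic)))).
    by rewrite eV /ham_lin /cubic_polar /cubic !(sum_sh _ ord0) !T0; apply/eqP; ring.
  have topT j : top_coef n.-1 (T j) (T j)`_n.-1 by split=> //; rewrite prednK ?sizeT.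
  have D20 : D ^+ 2 != 0 by rewrite expf_neq0 ?monic_neq0.
  have : (size (V * D ^+ 2)%R <= n + n + n)%N.
    have [sL _] := top_coefM topD2 (top_ham_lin topT k).
    have [sP _] := top_coefM topXD (top_polar topT).
    have [sC _] := top_cubic topT.
    rewrite eV (leq_trans (size_polyD _ _)) // geq_max.
    apply/andP; split; last by apply: leq_trans sC _; lia.
    rewrite (leq_trans (size_polyD _ _)) // geq_max.
    by apply/andP; split; [apply: leq_trans sL _ | apply: leq_trans sP _]; lia.
  have [->|V0] := eqVneq V 0; first by rewrite size_poly0.
  rewrite size_mul // expr2 size_Mmonic ?monic_neq0 // sizeD.
  by rewrite addSn /= !addnS /= -addnA leq_add2r.
have topV : top_coef n ('X * V) (('X * V)`_n).
  by split=> //; rewrite (leq_trans (size_polyMleq _ _)) // size_polyX ltnS.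
(* Multiplying by ['X ^+ 3] replaces each [T j] by ['X * T j], whose coefficient of degree [n] is
   [r j]. *)
have eV3 : 'X ^+ 2 * ('X * V * D ^+ 2) =
   'X ^+ 2 * (ham_lin A k (fun j => 'X * T j) * D ^+ 2
     + cubic_polar Cc (fun j => 'X * T j) * D) + cubic (fun j => 'X * T j).
  have -> : 'X ^+ 2 * ('X * V * D ^+ 2) = 'X ^+ 3 * (V * D ^+ 2) by ring.
  by rewrite eV cubic_scale cubic_polar_scale ham_lin_scale; ring.
have : (('X * V)`_n) * 1 = ham_lin a k r * 1 + cubic_polar c r * 1.
  have [_ <-] := top_coefM topV topD2.
  have [_ <-] := top_coefM (top_ham_lin topY k) topD2.
  have [_] := top_coefM (top_polar topY) topD; rewrite -addnA => <-.
  rewrite -coefD.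
  have [sC _] := top_cubic topY.
  (* Degree 3n + 2 is the formal top degree of the left side; the purely cubic term has degree at
     most 3n and does not contribute. *)
  have := congr1 (fun q : {poly C} => q`_(n + (n + n)).+2) eV3.
  rewrite [RHS]coefD !coefXnM /= !subSS !subn0 => ->.
  by rewrite (@coef_default _ (cubic _)) ?addr0 // (leq_trans sC) // addnA.
rewrite !mulr1 -ham_resE => <-.
rewrite lagrange_residue //; apply: eq_big_seq => p ps.
have rp : root D p by rewrite rootD.
have D'0 := simple_root rp; have /rootP Dp := rp.
rewrite hornerD hornerN hornerM Dp mulr0 subr0 /pole_weight.
have := congr1 (horner^~ p) eU'; rewrite /= hornerD hornerN !hornerM Dp.
rewrite mulr0 sub0r => eUp.
have eg : (cubic_grad N k).[p] = D^`().[p] ^+ 2 * cubic_grad (rho p) k.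
  rewrite cubic_grad_scale [RHS]mulrC divfK ?expf_neq0 //.
  by rewrite /cubic_grad !hornerD !hornerM.
apply: (mulIf D'0); rewrite divfK //; apply: (mulIf D'0).
by apply: oppr_inj; rewrite eUp eg mulNr mulNr opprK expr2 mulrC mulrA.
Qed.

Lemma no_pole : s = [::] -> D = 1 /\ forall j, N j = (c j)%:P * 'X.
Proof.
move=> s0; have D1 : D = 1 by rewrite splitD s0 big_nil.
split=> // j; have : T j = 0.
  by apply/eqP; rewrite -size_poly_leq0 (leq_trans (sizeT j)) // /n s0.
by rewrite /T D1 mulr1 => /eqP; rewrite subr_eq0 => /eqP.
Qed.

End PolynomialForm.

(** * Common denominators in lowest terms *)

Section RationalSolutions.
Variable R : realType.
Local Notation F := (RatF R).
Local Notation C := (Cx R).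
Local Notation tof := (@Defs.tof R).
Implicit Types (f g : 'I_5 -> F) (a b : 'I_5 -> C).

(** Starting from the product of the five denominators, roots common to [D] and all [N j] are
    divided out by induction on the degree of [D]. *)
Lemma reduced_form f : exists (N : 'I_5 -> {poly C}) (D : {poly C}),
  [/\ D \is monic, forall j, f j = tof (N j) / tof D
    & forall p, root D p -> exists j, ~~ root (N j) p].
Proof.
suff red m : forall (N : 'I_5 -> {poly C}) (D : {poly C}), (size D <= m)%N -> D != 0 ->
    (forall j, f j = tof (N j) / tof D) -> exists N' D',
  [/\ D' \is monic, forall j, f j = tof (N' j) / tof D'
    & forall p, root D' p -> exists j, ~~ root (N' j) p].
  have /choice[pq Hpq] : forall j, exists pq : {poly C} * {poly C},
      pq.2 != 0 /\ f j = tof pq.1 / tof pq.2.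
    by move=> j; have [p [q H]] := tof_fracP (f j); exists (p, q).
  pose D := \prod_j (pq j).2.
  apply: (red _ (fun j => (pq j).1 * \prod_(i | i != j) (pq i).2) D (leqnn _)).
    by apply/prodf_neq0 => j _; have [] := Hpq j.
  move=> j; have [qj ->] := Hpq j; set E := \prod_(i | _) _.
  have -> : D = (pq j).2 * E by rewrite /D (bigD1 j).
  rewrite !rmorphM -mulf_div divff ?mulr1 // tof_eq0.
  by apply/prodf_neq0 => i _; have [] := Hpq i.
elim: m => [|m IHm] N D sD D0 eN.
  by rewrite leqn0 size_poly_eq0 (negPf D0) in sD.
have [[p [Dp Np]]|nored] :=
    pselect (exists p, root D p /\ forall j, root (N j) p); last first.
  exists (fun j => (lead_coef D)^-1 *: N j), ((lead_coef D)^-1 *: D).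
  have l0 : (lead_coef D)^-1 != 0 by rewrite invr_eq0 lead_coef_eq0.
  split=> [|j|p].
  - by rewrite monicE lead_coefZ mulVf // lead_coef_eq0.
  - rewrite -!mul_polyC !rmorphM -mulf_div divff ?mul1r //.
    by rewrite tof_eq0 polyC_eq0.
  - rewrite rootZ // => Dp; apply: contrapT => noj; apply: nored.
    exists p; split=> // j; apply: contrapT => /negP Nj; apply: noj.
    by exists j; rewrite rootZ.
have l0 : tof ('X - p%:P) != 0 by rewrite tof_eq0 polyXsubC_eq0.
have /factor_theorem[D1 eD] := Dp.
have D10 : D1 != 0 by apply: contraNneq D0 => D10; rewrite eD D10 mul0r.
have /choice[N1 eN1] : forall j, exists q, N j = q * ('X - p%:P).
  by move=> j; apply/factor_theorem.
apply: (IHm N1 D1) => // [|j].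
  by move: sD; rewrite eD size_Mmonic ?monicXsubC // size_XsubC addn2.
by rewrite eN eN1 eD !rmorphM -mulf_div divff ?mulr1.
Qed.

Lemma common_denominator_identity (K : fieldType) (n d m w x : K) : d != 0 ->
  w / d ^+ 2 = n / d * (m / d) + x -> w = n * m + x * d ^+ 2.
Proof.
move=> d0 /(congr1 (fun z => z * d ^+ 2)); rewrite divfK ?expf_neq0 // => ->.
by field.
Qed.

Lemma alt_div (K : fieldType) (x : 'I_5 -> K) (e : K) j :
  alt (fun i => x i / e) j = alt x j / e.
Proof. by rewrite /alt; ring. Qed.

Lemma rational_structure a f : \sum_j a j = 1 -> is_A4_solution a f ->
  exists c r (s : seq C) (rho : C -> 'I_5 -> C),
  [/\ \sum_j c j = 1 /\ (forall j, c j * alt c j = 0),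
      forall j, r j = \sum_(p <- s) rho p j,
      forall p, p \in s -> [/\ \sum_j rho p j = 0,
        forall j, rho p j * (alt (rho p) j + 1) = 0 & exists j, rho p j != 0],
      (forall j, a j = infty_param c r j) /\
      (forall k, ham_res c r a k = \sum_(p <- s) pole_weight (rho p) k)
    & s = [::] -> forall j, f j = tvar R * cst (c j)].
Proof.
move=> sa sol; have [N [D [Dm eN red]]] := reduced_form f.
have D0 : tof D != 0 by rewrite tof_eq0 monic_neq0.
have eqN j : (N j)^`() * D - N j * D^`() = N j * alt N j + (a j)%:P * D ^+ 2.
  have := sol_eq j sol; rewrite eN fderiv_frac ?monic_neq0 //.
  rewrite (_ : alt f j = tof (alt N j) / tof D); last first.
    by rewrite (alt_morph tof) -alt_div; congr (alt _ j); apply/funext.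
  rewrite !rmorphXn => /(common_denominator_identity D0) e.
  by apply: (@tof_inj R); rewrite e [RHS]rmorphD; congr (_ + _);
    rewrite [RHS]rmorphM // rmorphXn.
have sumN : \sum_j N j = 'X * D.
  apply: (@tof_inj R); rewrite rmorphM rmorph_sum /=.
  have [_] := sol; rewrite /tvar => <-; rewrite mulr_suml; apply: eq_bigr => j _.
  by rewrite eN divfK.
have [s [splitD us]] := monic_split Dm eqN sumN red.
pose c j := (N j)`_(size s).+1.
pose T j := N j - (c j)%:P * ('X * D).
exists c, (fun j => ('X * T j)`_(size s)), s, (fun p j => (N j).[p] / D^`().[p]).
split.
- split; [exact: (sumc Dm sumN splitD) | exact: (altc eqN sumN splitD)].
- exact: (residue_sum Dm eqN sumN splitD us).
- move=> p ps; split.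
  + exact: (rho_sum sumN splitD ps).
  + by move=> j; apply: (rho_eq eqN sumN red splitD).
  + exact: (rho_neq0 eqN sumN red splitD ps).
- split.
  + exact: (param_infty Dm eqN sumN splitD).
  + exact: (ham_residue sa Dm eqN sumN red splitD us).
- move=> /(no_pole Dm eqN sumN splitD)[D1 NE] j.
  by rewrite eN D1 rmorph1 divr1 NE rmorphM mulrC.
Qed.

End RationalSolutions.

(** * Integral data at infinity and positivity of the Hamiltonian residues *)

Section Main.
Variable R : realType.
Local Notation F := (RatF R).
Local Notation C := (Cx R).
Implicit Types (f g : 'I_5 -> F) (a b : 'I_5 -> C) (X : 'I_5 -> int).

Definition pole_weightN (v : seq int) k : int :=
  - (cyc v (k + 1) * cyc v (k + 2) + cyc v (k + 4) * cyc v (k + 1)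
     + cyc v (k + 3) * cyc v (k + 4)).

Lemma pole_weightN_pos : all (fun v =>
  all (fun k => 0 <= pole_weightN v k) (iota 0 5)
  && (1 <= pole_weightN v 0 + pole_weightN v 1 + pole_weightN v 2
           + pole_weightN v 3 + pole_weightN v 4)) pole_types.
Proof. by vm_compute. Qed.

(** By [pole_classify] this is a finite check. The lower bound 1 on the total weight means that
    every pole is seen by some Hamiltonian. *)
Lemma pole_residue (rho : 'I_5 -> C) : \sum_j rho j = 0 ->
  (forall j, rho j * (alt rho j + 1) = 0) -> (exists j, rho j != 0) ->
  [/\ forall j, exists z : int, rho j = z%:~R,
      forall k, 0 <= pole_weight rho k & 1 <= \sum_k pole_weight rho k].
Proof.
move=> s e [j0 nz]; have [z|[i [v vT ev]]] := pole_classify s e.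
  by rewrite z eqxx in nz.
have ew k : pole_weight rho (sh i k) = (pole_weightN v k)%:~R.
  rewrite /pole_weight /cubic_grad !sh_sh !ev.
  by rewrite /pole_weightN rmorphN !rmorphD !rmorphM.
have /andP[/allP pos sum] := allP pole_weightN_pos v vT.
split=> [j|k|].
- by have [k _ ->] := sh_sub i j; exists (cyc v k).
- have [l l5 ->] := sh_sub i k.
  by rewrite ew ler0z pos // mem_iota.
- rewrite (sum_sh _ i) -{1}(sh0 i) !ew -!rmorphD /=.
  by rewrite -[1]/((1 : int)%:~R) ler_int.
Qed.

Lemma int_sum (I : eqType) (s : seq I) (G : I -> C) :
  (forall p, p \in s -> exists z : int, G p = z%:~R) ->
  exists z : int, \sum_(p <- s) G p = z%:~R.
Proof.
elim: s => [|p s IHs] H; first by exists 0; rewrite big_nil.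
have [z ez] := H p (mem_head _ _).
have [|w ew] := IHs; first by move=> q qs; apply: H; rewrite in_cons qs orbT.
by exists (z + w); rewrite big_cons ez ew rmorphD.
Qed.

Lemma infty_param_scale (V : comNzRingType) (x : V) (c r : 'I_5 -> V) j :
  infty_param (fun i => c i * x) r j = infty_param c r j * x.
Proof. by rewrite /infty_param /alt; ring. Qed.

Lemma ham_res_scale (V : comNzRingType) (x : V) (c r a : 'I_5 -> V) k :
  ham_res (fun i => c i * x) r (fun i => a i * x) k = ham_res c r a k * x.
Proof.
rewrite /ham_res [RHS]mulrDl [X in _ = _ + X]mulr_suml.
congr (_ + _); first by ring.
by apply: eq_bigr => j _; ring.
Qed.

Lemma infty_param_int (c r : 'I_5 -> int) j :
  (infty_param c r j)%:~R
  = infty_param (fun i => (c i)%:~R : C) (fun i => (r i)%:~R) j.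
Proof. by rewrite /infty_param /alt !(rmorphB, rmorphM, rmorphD). Qed.

Lemma ham_res_int (c r a : 'I_5 -> int) k :
  (ham_res c r a k)%:~R = ham_res (fun i => (c i)%:~R : C)
    (fun i => (r i)%:~R) (fun i => (a i)%:~R) k.
Proof.
rewrite /ham_res !(rmorphB, rmorphM, rmorphD) rmorph_sum; congr (_ + _).
by apply: eq_bigr => j _; rewrite !rmorphD !rmorphM.
Qed.

Lemma solution_data a f : \sum_j a j = 1 -> is_A4_solution a f ->
  exists (c r : 'I_5 -> int) i v,
  [/\ v \in infty_types /\ (forall k, c (sh i k) = cyc v k),
      \sum_j r j = 0,
      forall j, a j = (infty_param c r j)%:~R / 15,
      forall k, 0 <= ham_res c r (infty_param c r) k
    & (forall j, r j = 0) -> f = ray a].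
Proof.
move=> sa sol; have [c [r [s [rho H]]]] := rational_structure sa sol.
case: H => [[sc ec] er Hrho [ea eM] nopole].
have [i [v vT ev]] := infty_classify sc ec.
have fifteen_neq0 : (15 : C) != 0 by rewrite pnatr_eq0.
have /choice[ci eci] : forall j, exists z : int, c j = z%:~R / 15.
  by move=> j; have [k _ ->] := sh_sub i j; exists (cyc v k).
have Hrho' p : p \in s -> [/\ forall j, exists z : int, rho p j = z%:~R,
    forall k, 0 <= pole_weight (rho p) k & 1 <= \sum_k pole_weight (rho p) k].
  by case/Hrho => *; apply: pole_residue.
have /choice[ri eri] : forall j, exists z : int, r j = z%:~R.
  by move=> j; rewrite er; apply: int_sum => p /Hrho'[+ _ _]; apply.
have eC : c = fun j => (ci j)%:~R * 15^-1 by apply/funext.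
have eR : r = fun j => (ri j)%:~R by apply/funext.
have eA j : a j = (infty_param ci ri j)%:~R / 15.
  by rewrite ea eC eR infty_param_scale infty_param_int.
have eA' : a = fun j => (infty_param ci ri j)%:~R * 15^-1 by apply/funext.
have eH k : ham_res c r a k = (ham_res ci ri (infty_param ci ri) k)%:~R * 15^-1.
  by rewrite {1}eA' eC eR ham_res_scale ham_res_int.
have M0 k : 0 <= ham_res c r a k.
  by rewrite eM big_seq; apply: sumr_ge0 => p /Hrho'[].
exists ci, ri, i, v; split; [| |exact: eA|move=> k|move=> r0].
- split=> // k; apply: (@intr_inj C); apply: (mulIf (invr_neq0 fifteen_neq0)).
  by rewrite -eci ev.
- apply: (@intr_inj C); rewrite rmorph_sum /= rmorph0.
  rewrite (eq_bigr r) => [|j _]; last by rewrite eri.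
  rewrite (eq_bigr _ (fun j _ => er j)) exchange_big big_seq big1 // => p ps.
  by have [] := Hrho p ps.
- have := M0 k; rewrite eH pmulr_lge0 ?ler0z //.
  by rewrite invr_gt0 ltr0n.
- have rz j : r j = 0 by rewrite eri r0.
  (* Every term of [ham_res] contains a factor [r], so for [r = 0] the total weight of all poles is
     0, whereas each pole contributes at least 1. *)
  have s0 : s = [::].
    have Mz k : \sum_(p <- s) pole_weight (rho p) k = 0.
      rewrite -eM /ham_res !rz !mulr0 big1 ?subr0 ?addr0 // => j _.
      by rewrite !rz !mulr0 !mul0r !addr0.
    case es : s Hrho' Mz => [|p s'] // Hrho' Mz.
    have : \sum_k \sum_(p <- p :: s') pole_weight (rho p) k >= 1.
      rewrite exchange_big big_cons /=.
      have [_ _ w1] := Hrho' p (mem_head _ _).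
      apply: (le_trans w1); rewrite lerDl big_seq; apply: sumr_ge0 => q qs.
      have [|_ wq _] := Hrho' q; first by rewrite in_cons qs orbT.
      by apply: sumr_ge0 => k _; apply: wq.
    by rewrite big1 ?ler10.
  apply/funext => j; rewrite (nopole s0) /ray ea /infty_param /alt !rz.
  by rewrite !subr0 addr0 mulr0 mul0r !subr0.
Qed.

End Main.

(** * Classification *)

Section Classified.
Variable R : realType.
Local Notation F := (RatF R).
Local Notation C := (Cx R).
Implicit Types (f g : 'I_5 -> F) (a b : 'I_5 -> C) (X : 'I_5 -> int).

Definition fifteenth X : 'I_5 -> C := fun j => (X j)%:~R / 15.

Definition condn m a : Prop :=
  match m with 0 => cond1 a | 1 => cond2 a | _ => cond3 a end.

Definition seedn m : state R :=
  match m with 0 => seed1 R | 1 => seed2 R | _ => seed3 R end.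

Lemma fifteen_neq0 : (15 : C) != 0.
Proof. by rewrite pnatr_eq0. Qed.

Lemma fifteenth_inj (z w : int) : z%:~R / 15 = w%:~R / 15 :> C -> z = w.
Proof. by move/(mulIf (invr_neq0 fifteen_neq0))/intr_inj. Qed.

Lemma congZ_fifteenth (z w : int) :
  congZ (z%:~R / 15 : C) (w%:~R / 15) <-> (15 %| z - w)%Z.
Proof.
split=> [[t e]|/dvdzP[t e]].
  apply/dvdzP; exists t; apply: fifteenth_inj.
  by rewrite rmorphB rmorphM /= mulrBl e mulfK // fifteen_neq0.
exists t; rewrite -mulrBl -rmorphB /= e rmorphM /= mulfK //; exact: fifteen_neq0.
Qed.

Lemma pattern_congZ X i (e : C) (q : int) (l : seq int) :
  size l = 5%N -> e = q%:~R / 15 ->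
  (forall k : 'I_5, congZ (fifteenth X (sh i k)) (e * vec5 R l k)) <->
  (forall k, (15 %| X (sh i k) - cyc [seq q * x | x <- l] k)%Z).
Proof.
move=> sl ->; have E (k : 'I_5) :
    q%:~R / 15 * vec5 R l k = (cyc [seq q * x | x <- l] k)%:~R / 15.
  rewrite /cyc modn_small // (nth_map 0) ?sl // rmorphM /vec5.
  by rewrite mulrAC.
split=> H k.
  rewrite -cycM -shM; have k5 : (k %% 5 < 5)%N by rewrite ltn_mod.
  by have := H (Ordinal k5); rewrite E => /congZ_fifteenth.
by rewrite E; apply/congZ_fifteenth.
Qed.

Lemma pattern_integral a i (e : C) (q : int) (l : seq int) :
  e = q%:~R / 15 ->
  (forall k : 'I_5, congZ (a (sh i k)) (e * vec5 R l k)) ->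
  exists X, a = fifteenth X.
Proof.
move=> -> H.
suff /choice[X eX] : forall j, exists z : int, a j = z%:~R / 15.
  by exists X; apply/funext.
move=> j; have [k k5 ->] := sh_sub i j; have [z /eqP] := H (Ordinal k5).
rewrite subr_eq => /eqP -> /=; exists (z * 15 + q * l`_k).
rewrite rmorphD !rmorphM /= mulrDl mulfK ?fifteen_neq0 // /vec5 /=.
by rewrite mulrAC.
Qed.

Lemma third_fifteenth : (3^-1 : C) = (5 : int)%:~R / 15.
Proof. by field; rewrite ?pnatr_eq0. Qed.

Lemma opp_third_fifteenth : - (3^-1 : C) = (-5 : int)%:~R / 15.
Proof. by rewrite third_fifteenth rmorphN mulNr. Qed.

Lemma fifths_fifteenth (j : nat) : (j%:R / 5 : C) = (3 * Posz j)%:~R / 15.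
Proof. by rewrite rmorphM /=; field; rewrite ?pnatr_eq0. Qed.

Lemma cond_integral a : cond1 a \/ cond2 a \/ cond3 a ->
  exists X, a = fifteenth X.
Proof.
case=> [H|[[i [e [e3 H]]]|[i [j [_ H]]]]].
- have /choice[X eX] := H; exists (fun j => X j * 15); apply/funext => j.
  by rewrite /fifteenth rmorphM /= mulfK ?fifteen_neq0.
- have [q eq] : exists q : int, e = q%:~R / 15.
    by case: e3 => ->; [exists 5; rewrite third_fifteenth
                       | exists (-5); rewrite opp_third_fifteenth].
  by case: H => /(pattern_integral eq).
- by case: H => /(pattern_integral (fifths_fifteenth j)).
Qed.

Lemma condn_congX m X : (m < 3)%N ->
  condn m (fifteenth X) <-> congX (resn m) X.
Proof.
case: m => [|[|[|//]]] _ /=.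
- split=> [H|[i [v]]].
    exists ord0; exists [:: 0; 0; 0; 0; 0] => // k.
    have [z ez] := H (sh ord0 k); apply/congZ_fifteenth; exists z.
    rewrite /cyc (_ : nth _ _ _ = 0) ?mul0r ?subr0 //.
    by case: (k %% 5)%N => [|[|[|[|[|l]]]]] //=; rewrite nth_nil.
  rewrite inE => /eqP-> H j; have [k _ ->] := sh_sub i j.
  have /congZ_fifteenth[z] := H k; rewrite /cyc (_ : nth _ _ _ = 0).
    by rewrite mul0r subr0 => ez; exists z.
  by case: (k %% 5)%N => [|[|[|[|[|l]]]]] //=; rewrite nth_nil.
- pose l1 : seq int := [:: 1; 1; 1; 0; 0].
  pose l2 : seq int := [:: 1; -1; -1; 1; 0].
  have T1 i := pattern_congZ X i (erefl : size l1 = 5%N) third_fifteenth.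
  have T2 i := pattern_congZ X i (erefl : size l2 = 5%N) third_fifteenth.
  have N1 i := pattern_congZ X i (erefl : size l1 = 5%N) opp_third_fifteenth.
  have N2 i := pattern_congZ X i (erefl : size l2 = 5%N) opp_third_fifteenth.
  split=> [[i [e [[]-> []H]]]|[i [v]]].
  + by exists i; exists [:: 5; 5; 5; 0; 0] => //; apply/T1.
  + by exists i; exists [:: 5; -5; -5; 5; 0] => //; apply/T2.
  + by exists i; exists [:: -5; -5; -5; 0; 0] => //; apply/N1.
  + by exists i; exists [:: -5; 5; 5; -5; 0] => //; apply/N2.
  rewrite !inE => /or4P[] /eqP-> H; exists i.
  + by exists 3^-1; split; [left | left; apply/T1].
  + by exists (- 3^-1); split; [right | left; apply/N1].
  + by exists 3^-1; split; [left | right; apply/T2].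
  + by exists (- 3^-1); split; [right | right; apply/N2].
- split=> [[i [j [j14 H]]]|[i [v /allpairsP[[j l] [jI lI ->]] H]]].
    have jI : j \in [:: 1; 2; 3; 4]%N by rewrite !inE; lia.
    case: H => H; exists i; [exists [seq 3 * Posz j * x | x <- [:: 1; 1; 1; 1; 1]]
                 | exists [seq 3 * Posz j * x | x <- [:: 1; 2; 1; 3; 3]]].
    + by apply/allpairsP; exists (j, [:: 1; 1; 1; 1; 1]).
    + by apply/(pattern_congZ X i _ (fifths_fifteenth j)).
    + by apply/allpairsP; exists (j, [:: 1; 2; 1; 3; 3]).
    + by apply/(pattern_congZ X i _ (fifths_fifteenth j)).
  exists i, j; split; first by move: jI; rewrite /= !inE; lia.
  by move: lI H; rewrite !inE => /orP[]/eqP-> H; [left|right];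
    apply/(pattern_congZ X i _ (fifths_fifteenth j)).
Qed.

Lemma fifteenth_sact X i : fifteenth (sact i X) = sact i (fifteenth X).
Proof.
apply/funext => j; rewrite /fifteenth /sact; case: eqP => // _.
  by rewrite rmorphN mulNr.
by case: ifP => // _; rewrite rmorphD mulrDl.
Qed.

Lemma fifteenth_sum X : \sum_j X j = 15 -> \sum_j fifteenth X j = 1.
Proof. by move=> sX; rewrite -mulr_suml -rmorph_sum sX divff ?fifteen_neq0. Qed.

Lemma seedn_ray m X i : (m < 3)%N ->
  (forall k, X (sh i k) = cyc (chamber_pt m) k) ->
  backlund (nseq i Gpi) (ray (fifteenth X), fifteenth X) = seedn m.
Proof.
move=> m3 eX; rewrite backlund_pi.
have E (j : 'I_5) : X (sh j i) = (chamber_pt m)`_j.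
  by rewrite /sh addnC -/(sh i j) eX /cyc modn_small.
have c0 : (0 : int)%:~R / 15 = 0 :> C by rewrite mul0r.
have c15 : (15 : int)%:~R / 15 = 1 :> C by rewrite divff ?fifteen_neq0.
have c5 : (5 : int)%:~R / 15 = 3^-1 :> C by rewrite third_fifteenth.
have c3 : (3 : int)%:~R / 15 = 5^-1 :> C by field; rewrite ?pnatr_eq0.
have f0 : tvar R * cst 0 = 0 by rewrite rmorph0 mulr0.
have f1 : tvar R * cst 1 = tvar R by rewrite rmorph1 mulr1.
have f3 : tvar R * cst 3^-1 = tvar R / 3 by rewrite fmorphV rmorph_nat.
have f5 : tvar R * cst 5^-1 = tvar R / 5 by rewrite fmorphV rmorph_nat.
case: m m3 E {eX} => [|[|[|//]]] _ E; congr pair; apply/funext => j;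
  rewrite /ray /fifteenth E; case: j => [[|[|[|[|[|//]]]]] p];
  by rewrite /= ?c0 ?c15 ?c5 ?c3 ?f0 ?f1 ?f3 ?f5.
Qed.

Definition classified a : Prop :=
  ((exists f, is_A4_solution a f) <-> cond1 a \/ cond2 a \/ cond3 a)
  /\ (forall f g, is_A4_solution a f -> is_A4_solution a g -> f = g)
  /\ (forall f, is_A4_solution a f ->
        (cond1 a -> exists w, backlund w (f, a) = seed1 R)
        /\ (cond2 a -> exists w, backlund w (f, a) = seed2 R)
        /\ (cond3 a -> exists w, backlund w (f, a) = seed3 R)).

Lemma chamber_pt_congX m X i : (m < 3)%N ->
  (forall k, X (sh i k) = cyc (chamber_pt m) k) -> congX (resn m) X.
Proof.
have cong0 v : v \in resn m ->
    (forall k, X (sh i k) = cyc v k) -> congX (resn m) X.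
  by move=> vB eX; exists i; exists v => // k; rewrite eX subrr dvdz0.
case: m cong0 => [|[|[|//]]] cong0 _ eX; last first.
- by apply: cong0 eX; apply/allpairsP; exists (1%N, [:: 1; 1; 1; 1; 1]).
- exact: cong0 eX.
exists i; exists [:: 0; 0; 0; 0; 0] => // k; rewrite eX /cyc.
by case: (k %% 5)%N => [|[|[|[|[|l]]]]] //=; rewrite !nth_nil.
Qed.

Lemma sol_chamber_pt m X i : (m < 3)%N -> \sum_j X j = 15 ->
  (forall k, X (sh i k) = cyc (chamber_pt m) k) ->
  is_A4_solution (fifteenth X) (ray (fifteenth X)).
Proof.
move=> m3 sX eX; apply: sol_ray; first exact: fifteenth_sum.
move=> j; have [k k5 ->] := sh_sub i j.
have chk : all (fun m => all (fun k => cyc (chamber_pt m) k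
    * altN (cyc (chamber_pt m)) k == 0) (iota 0 5)) (iota 0 3) by vm_compute.
have mI : m \in iota 0 3 by rewrite mem_iota.
have kI : k \in iota 0 5 by rewrite mem_iota.
have /eqP := allP (allP chk m mI) k kI.
rewrite /fifteenth (alt_div (fun i => (X i)%:~R)) mulf_div.
rewrite -(alt_morph (intmul 1 : int -> C)) /alt !sh_sh /= !eX -/(altN _ k).
by rewrite -rmorphM /= => ->; rewrite mul0r.
Qed.

Lemma conds_condn a :
  cond1 a \/ cond2 a \/ cond3 a <-> exists2 m, (m < 3)%N & condn m a.
Proof.
split=> [[H|[H|H]]|[[|[|[|//]]] _ H]]; [by exists 0%N | by exists 1%N
  | by exists 2%N | by left | by right; left | by right; right].
Qed.

Lemma classified_of a :
  ((exists f, is_A4_solution a f) <-> exists2 m, (m < 3)%N & condn m a) ->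
  (forall f g, is_A4_solution a f -> is_A4_solution a g -> f = g) ->
  (forall f m, (m < 3)%N -> is_A4_solution a f -> condn m a ->
     exists w, backlund w (f, a) = seedn m) ->
  classified a.
Proof.
move=> H1 H2 H3; split; first by rewrite conds_condn.
split=> // f sf; split=> [c|]; first exact: (H3 f 0%N).
by split=> c; [apply: (H3 f 1%N) | apply: (H3 f 2%N)].
Qed.

(** [chamber_rigid] gives [r = 0], which excludes poles and makes the parameters equal to the
    leading coefficients. *)
Lemma chamber_solution X f : \sum_j X j = 15 -> (forall j, 0 <= X j) ->
  is_A4_solution (fifteenth X) f -> f = ray (fifteenth X) /\
  exists m i, (m < 3)%N /\ forall k, X (sh i k) = cyc (chamber_pt m) k.
Proof.
move=> sX X0 sol.
have [c [r [i [v [[vT ev] sr ea M0 rz]]]]] := solution_data (fifteenth_sum sX) sol.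
have eX j : X j = infty_param c r j by apply: fifteenth_inj; apply: ea.
have eX' : X = infty_param c r by apply/funext.
have M0' k : 0 <= ham_res c r X k by rewrite eX'.
have [r0 [m m3 vm]] := chamber_rigid vT ev sr eX X0 M0'.
split; first exact: rz.
exists m, i; split=> // k; rewrite eX /infty_param /alt !r0 ev vm.
by ring.
Qed.

Lemma classified_chamber X : \sum_j X j = 15 -> (forall j, 0 <= X j) ->
  classified (fifteenth X).
Proof.
move=> sX X0; apply: classified_of => [|f g sf sg|f m m3 sf cm].
- split=> [[f sf]|[m m3 cm]].
    have [_ [m [i [m3 eX]]]] := chamber_solution sX X0 sf.
    by exists m => //; apply/condn_congX => //; apply: chamber_pt_congX eX.
  have /(condn_congX _ m3) cX := cm.
  have [i eX] := chamber_congX m3 cX X0 sX.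
  by exists (ray (fifteenth X)); apply: sol_chamber_pt eX.
- have [-> _] := chamber_solution sX X0 sf.
  by have [-> _] := chamber_solution sX X0 sg.
- have [-> _] := chamber_solution sX X0 sf.
  have /(condn_congX _ m3) cX := cm.
  have [i eX] := chamber_congX m3 cX X0 sX.
  by exists (nseq i Gpi); apply: seedn_ray.
Qed.

Lemma stable_resn m : (m < 3)%N -> stable (resn m).
Proof.
by have /and3P[s1 s2 s3] := stable_res; case: m => [|[|[|//]]] _.
Qed.

Lemma condn_sact m X i : (m < 3)%N ->
  condn m (fifteenth (sact i X)) <-> condn m (fifteenth X).
Proof.
move=> m3; split=> /(condn_congX _ m3) H; apply/(condn_congX _ m3).
  by rewrite -(sact_invol i X); apply: congX_sact => //; apply: stable_resn.
by apply: congX_sact => //; apply: stable_resn.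
Qed.

(** The reflection is a bijection between the two solution sets and preserves each of the three
    conditions, so all claims transfer back. *)
Lemma classified_sact X i :
  classified (fifteenth (sact i X)) -> classified (fifteenth X).
Proof.
have eS := fifteenth_sact X i; case=> [ex [uniq words]].
have back f : is_A4_solution (fifteenth (sact i X)) f ->
    is_A4_solution (fifteenth X) (sfun i (fifteenth (sact i X)) f).
  by move=> sf; have := sol_sact i sf; rewrite -fifteenth_sact sact_invol.
have forth f : is_A4_solution (fifteenth X) f ->
    is_A4_solution (fifteenth (sact i X)) (sfun i (fifteenth X) f).
  by move=> /(sol_sact i); rewrite eS.
apply: classified_of => [|f g sf sg|f m m3 sf cm].
- split=> [[f /forth sf]|[m m3 cm]].
    have /conds_condn[m m3 cm] : _ := (proj1 ex) (ex_intro _ _ sf).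
    by exists m => //; apply/(condn_sact X i m3).
  have [|f /back sf] := proj2 ex; last by eexists; apply: sf.
  by apply/conds_condn; exists m => //; apply/(condn_sact X i m3).
- by apply: (@sfun_inj _ (fifteenth X) i); apply: uniq; apply: forth.
- have [w ew] : exists w,
      backlund w (sfun i (fifteenth X) f, fifteenth (sact i X)) = seedn m.
    have [w1 [w2 w3]] := words _ (forth _ sf).
    have := proj2 (condn_sact X i m3) cm.
    by case: m m3 cm => [|[|[|//]]] _ _; [apply: w1 | apply: w2 | apply: w3].
  (* [backlund] is a right fold: the last letter acts first. *)
  exists (rcons w (Gs i)); rewrite -cats1 backlund_cat /=.
  by have := act_sE i sf; rewrite /= => ->; rewrite -eS.
Qed.

Lemma classified_all a : \sum_j a j = 1 -> classified a.
Proof.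
(* Outside multiples of 1/15 every claim is vacuous or false on both sides: a solution forces
   integrality by [solution_data], and each condition does by [cond_integral]. *)
move=> sa; have [[X eX]|nX] := pselect (exists X, a = fifteenth X); last first.
  have nosol f : ~ is_A4_solution a f.
    move=> sf; have [c [r [_ [_ [_ _ ea _ _]]]]] := solution_data sa sf.
    by apply: nX; exists (infty_param c r); apply/funext.
  split; last by split=> [f g|f] /nosol.
  by split=> [[f /nosol]|/cond_integral/nX].
have sX : \sum_j X j = 15.
  apply: fifteenth_inj; transitivity (\sum_j a j); last first.
    by rewrite sa divff ?fifteen_neq0.
  by rewrite eX -mulr_suml -rmorph_sum.
rewrite eX; move: X sX {eX}; apply: chamber_ind; first exact: classified_chamber.
by move=> X i _; apply: classified_sact.
Qed.

End Classified.

Theorem theorem0p1 (R : realType) (a : 'I_5 -> Cx R) :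
  \sum_(j < 5) a j = 1 ->
  ((exists f : 'I_5 -> RatF R, is_A4_solution a f) <->
     cond1 a \/ cond2 a \/ cond3 a)
  /\ (forall f g : 'I_5 -> RatF R,
        is_A4_solution a f -> is_A4_solution a g -> f = g)
  /\ (forall f : 'I_5 -> RatF R, is_A4_solution a f ->
        (cond1 a -> exists w, backlund w (f, a) = seed1 R)
        /\ (cond2 a -> exists w, backlund w (f, a) = seed2 R)
        /\ (cond3 a -> exists w, backlund w (f, a) = seed3 R)).
Proof. exact: classified_all. Qed.
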